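(* Let $U \subseteq V$ be an immediate extension of DVRs with quotient fields $Q$ and $F$, respectively. Then the following are equivalent. (1) There exists an analytically ramified local Noetherian domain containing $U$ and having normalization $V$. (2) Either $F$ has characteristic $0$ and $F/Q$ is not algebraic, or $F$ has characteristic $p>0$ and $F \ne Q[F^p]$.
   Context: A DVR is a rank one discrete valuation ring; $\mathfrak{M}_V$ denotes the maximal ideal of $V$. An extension of DVRs $U \subseteq V$ is immediate if $U$ and $V$ have the same value group and residue field; equivalently, $\mathfrak{M}_U \subseteq \mathfrak{M}_V$ and $V = U + \mathfrak{M}_U V$. The normalization of a domain is its integral closure in its quotient field. A local Noetherian ring is analytically ramified if its completion in the topology of its maximal ideal has a nonzero nilpotent element. For a field $F$ of characteristic $p>0$, $F^p$ is the subfield of $p$-th powers, and $Q[F^p]$ is the subfield of $F$ generated by $Q$ and $F^p$. *)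

(* Defs.v *)
From HB Require Import structures.
From mathcomp Require Import all_boot all_order all_algebra ring_quotient.
From mathcomp Require Import boolp classical_sets functions.

Set Implicit Arguments.
Unset Strict Implicit.
Unset Printing Implicit Defensive.

Import Order.TTheory GRing.Theory Num.Theory.
Local Open Scope ring_scope.

(* MathComp's [idealr A] is the structure of PROPER ideals of [A]. *)

Section Ideals.
Variable A : comNzRingType.

Definition ideal_span (G : {pred A}) : {pred A} := fun x =>
  `[< exists2 s : seq (A * A),
        {in s, forall c, c.2 \in G} & x = \sum_(c <- s) c.1 * c.2 >].

(* The unit ideal, not covered by [idealr A], is generated by 1. *)
Definition noetherian : Prop :=
  forall I : idealr A, exists s : seq A, I =i ideal_span (mem s).

Fixpoint ideal_pow (I : {pred A}) (n : nat) : {pred A} :=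
  if n is m.+1 then
    ideal_span (fun x =>
      `[< exists a b, [/\ a \in I, b \in ideal_pow I m & x = a * b] >])
  else predT.

Lemma ideal_span0 G : 0 \in ideal_span G.
Proof. by apply/asboolP; exists [::]; rewrite ?big_nil. Qed.

Lemma ideal_spanD G : {in ideal_span G &, forall x y, x + y \in ideal_span G}.
Proof.
move=> x y /asboolP[s sG ->] /asboolP[t tG ->]; apply/asboolP.
exists (s ++ t); last by rewrite big_cat.
by move=> c; rewrite mem_cat => /orP[/sG|/tG].
Qed.

Lemma ideal_spanM G a : {in ideal_span G, forall x, a * x \in ideal_span G}.
Proof.
move=> x /asboolP[s sG ->]; apply/asboolP.
exists [seq (a * c.1, c.2) | c <- s].
  by move=> _ /mapP[c /sG ? ->].
by rewrite big_map mulr_sumr; apply: eq_bigr => c _; rewrite mulrA.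
Qed.

Lemma ideal_pow0 I n : 0 \in ideal_pow I n.
Proof. by case: n => //= n; apply: ideal_span0. Qed.

Lemma ideal_powD I n :
  {in ideal_pow I n &, forall x y, x + y \in ideal_pow I n}.
Proof. by case: n => //= n; apply: ideal_spanD. Qed.

Lemma ideal_powM I n a :
  {in ideal_pow I n, forall x, a * x \in ideal_pow I n}.
Proof. by case: n => //= n; apply: ideal_spanM. Qed.

Lemma ideal_powN I n : {in ideal_pow I n, forall x, - x \in ideal_pow I n}.
Proof. by move=> x Ix; rewrite -mulN1r ideal_powM. Qed.

Lemma ideal_powB I n :
  {in ideal_pow I n &, forall x y, x - y \in ideal_pow I n}.
Proof. by move=> x y Ix Iy; rewrite ideal_powD ?ideal_powN. Qed.

Lemma ideal_pow1_sub (I : idealr A) : {subset ideal_pow I 1 <= I}.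
Proof.
move=> x /asboolP[s sI ->]; rewrite big_seq; apply: rpred_sum => c /sI.
by move=> /asboolP[a [b [Ia _ ->]]]; rewrite idealMr // mulrC idealMr.
Qed.

End Ideals.

Section Completion.
Variables (A : comNzRingType) (I : idealr A).

Definition adic_cauchy : {pred (nat -> A)} := fun x =>
  `[< forall k, exists N, forall m n, (N <= m)%N -> (N <= n)%N ->
        x m - x n \in ideal_pow I k >].

Lemma adic_cauchy_subring : subring_closed adic_cauchy.
Proof.
split.
- by apply/asboolP => k; exists 0%N => m n _ _; rewrite /= subrr ideal_pow0.
- move=> x y /asboolP cx /asboolP cy; apply/asboolP => k.
  have [N1 h1] := cx k; have [N2 h2] := cy k.
  exists (maxn N1 N2) => m n; rewrite !geq_max => /andP[m1 m2] /andP[n1 n2].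
  have -> : (x - y) m - (x - y) n = (x m - x n) - (y m - y n).
    by rewrite !fctE opprD !opprK opprB addrACA [in RHS]addrC addrC [y n - _]addrC.
  by apply: ideal_powB; [apply: h1 | apply: h2].
- move=> x y /asboolP cx /asboolP cy; apply/asboolP => k.
  have [N1 h1] := cx k; have [N2 h2] := cy k.
  exists (maxn N1 N2) => m n; rewrite !geq_max => /andP[m1 m2] /andP[n1 n2].
  have -> : (x * y) m - (x * y) n = y m * (x m - x n) + x n * (y m - y n).
    rewrite !fctE !mulrBr [y m * x m]mulrC [y m * x n]mulrC addrA.
    by rewrite subrK.
  by apply: ideal_powD; apply: ideal_powM; [apply: h1 | apply: h2].
Qed.

HB.instance Definition _ :=
  GRing.isSubringClosed.Build (nat -> A) adic_cauchy adic_cauchy_subring.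

Record cauchy_seq :=
  CauchySeq { cauchy_val : nat -> A; _ : cauchy_val \in adic_cauchy }.
HB.instance Definition _ := [isSub for cauchy_val].
HB.instance Definition _ := [Choice of cauchy_seq by <:].
HB.instance Definition _ :=
  [SubChoice_isSubComNzRing of cauchy_seq by <:].

Definition adic_null : {pred cauchy_seq} := fun x =>
  `[< forall k, exists N, forall n, (N <= n)%N -> val x n \in ideal_pow I k >].

Lemma adic_null_ideal : idealr_closed adic_null.
Proof.
split.
- by apply/asboolP => k; exists 0%N => n _; rewrite /= ideal_pow0.
- apply/negP => /asboolP /(_ 1%N)[N /(_ N (leqnn N))] /ideal_pow1_sub.
  by rewrite /= idealr1.
- move=> a x y /asboolP nx /asboolP ny; apply/asboolP => k.
  have [N1 h1] := nx k; have [N2 h2] := ny k.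
  exists (maxn N1 N2) => n; rewrite geq_max => /andP[n1 n2] /=.
  by apply: ideal_powD; [apply: ideal_powM; apply: h1 | apply: h2].
Qed.

HB.instance Definition _ :=
  isIdealr.Build cauchy_seq adic_null adic_null_ideal.

(* The [I]-adic completion: Cauchy sequences modulo null sequences. *)
Definition completion := {ideal_quot adic_null}.
HB.instance Definition _ := GRing.ComNzRing.on completion.

End Completion.

Section LocalRings.
Variable A : comUnitRingType.

Definition nonunits : {pred A} := [predC GRing.unit].

Definition local_ring : Prop := idealr_closed nonunits.

(* [M] is the maximal ideal of the local ring [A]. *)
Definition analytically_ramified : Prop :=
  exists2 M : idealr A, M =i nonunits &
    exists2 x : completion M, x != 0 & exists n : nat, x ^+ n = 0.

End LocalRings.

Section Subrings.
Variables (F : fieldType) (S : subringClosed F).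

Definition units_of : {pred F} := [pred x | [&& x != 0, x \in S & x^-1 \in S]].

(* For a local ring [S], such as a DVR, this is its maximal ideal. *)
Definition nonunits_of : {pred F} := [pred x | (x \in S) && (x \notin units_of)].

Record subring_type := SubringType { subring_val : F; _ : subring_val \in S }.
HB.instance Definition _ := [isSub for subring_val].
HB.instance Definition _ := [Choice of subring_type by <:].
HB.instance Definition _ :=
  [SubChoice_isSubComNzRing of subring_type by <:].

Definition subring_unit : pred subring_type := [pred x | val x \in units_of].

Definition subring_inv (x : subring_type) : subring_type :=
  insubd x (val x)^-1.

Lemma subring_mulVr : {in subring_unit, left_inverse 1 subring_inv *%R}.
Proof.
move=> x /and3P[x0 _ Vx]; apply: val_inj.
by rewrite /= /subring_inv val_insubd Vx mulVf.
Qed.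

Lemma subring_unitP (x y : subring_type) : y * x = 1 -> subring_unit x.
Proof.
move=> /(congr1 val) /= yx; have x0 : val x != 0.
  by apply: contra_eq_neq yx => ->; rewrite mulr0 eq_sym oner_neq0.
apply/and3P; split=> //; first exact: valP.
suff -> : (val x)^-1 = val y by apply: valP.
by apply: (mulIf x0); rewrite mulVf.
Qed.

Lemma subring_inv_out : {in [predC subring_unit], subring_inv =1 id}.
Proof.
move=> x; rewrite inE => /negP ux; apply: val_inj.
rewrite /subring_inv val_insubd; case: ifP => // Vx.
have [->|x0] := eqVneq (val x) 0; first by rewrite invr0.
by case: ux; apply/and3P; split=> //; apply: valP.
Qed.

HB.instance Definition _ := GRing.ComNzRing_hasMulInverse.Build subring_type
  subring_mulVr subring_unitP subring_inv_out.

Lemma subring_integral : GRing.integral_domain_axiom subring_type.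
Proof.
move=> x y /(congr1 val) /= /eqP; rewrite mulf_eq0.
by case/orP => /eqP h; apply/orP; [left | right]; apply/eqP/val_inj.
Qed.

HB.instance Definition _ :=
  GRing.ComUnitRing_isIntegral.Build subring_type subring_integral.

Definition quotient_field : {pred F} := fun x =>
  `[< exists a b, [/\ a \in S, b \in S, b != 0 & x = a / b] >].

Lemma quotient_field_divring : divring_closed quotient_field.
Proof.
split.
- by apply/asboolP; exists 1, 1; rewrite rpred1 oner_neq0 divr1.
- move=> _ _ /asboolP[a [b [Sa Sb b0 ->]]] /asboolP[c [d [Sc Sd d0 ->]]].
  apply/asboolP; exists (a * d - c * b), (b * d).
  by rewrite rpredB ?rpredM ?mulf_neq0 // -[- (c / d)]mulNr addf_div // mulNr.
- move=> _ _ /asboolP[a [b [Sa Sb b0 ->]]] /asboolP[c [d [Sc Sd d0 ->]]].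
  have [->|c0] := eqVneq c 0.
    apply/asboolP; exists 0, 1.
    by rewrite mul0r invr0 mulr0 mul0r rpred0 rpred1 oner_neq0.
  apply/asboolP; exists (a * d), (b * c).
  by rewrite !rpredM ?mulf_neq0 // invf_div mulf_div.
Qed.

HB.instance Definition _ :=
  GRing.isDivringClosed.Build F quotient_field quotient_field_divring.

Record quotient_field_type := QuotientFieldType {
  quotient_field_val : F; _ : quotient_field_val \in quotient_field }.
HB.instance Definition _ := [isSub for quotient_field_val].
HB.instance Definition _ := [Choice of quotient_field_type by <:].
HB.instance Definition _ :=
  [SubChoice_isSubComNzRing of quotient_field_type by <:].
HB.instance Definition _ :=
  [SubNzRing_isSubUnitRing of quotient_field_type by <:].
HB.instance Definition _ :=
  [SubComUnitRing_isSubIntegralDomain of quotient_field_type by <:].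
HB.instance Definition _ :=
  [SubIntegralDomain_isSubField of quotient_field_type by <:].

Definition normalization : {pred F} := fun x =>
  `[< x \in quotient_field /\
      integralOver (val : subring_type -> F) x >].

(* [v] is only relevant on the nonzero elements of the quotient field. *)
Definition discrete_valuation_on (K : {pred F}) (v : F -> int) : Prop :=
  [/\ {in K &, forall x y, x != 0 -> y != 0 -> v (x * y) = v x + v y},
      {in K &, forall x y, x != 0 -> y != 0 -> x + y != 0 ->
         Num.min (v x) (v y) <= v (x + y)}
    & forall n : int, exists2 x, x \in K & x != 0 /\ v x = n].

Definition dvr : Prop :=
  exists2 v : F -> int, discrete_valuation_on quotient_field v &
    {in quotient_field, forall x, (x \in S) = (x == 0) || (0 <= v x)}.

End Subrings.

Section Extensions.
Variables (F : fieldType) (U V : subringClosed F).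

(* The value group of a valuation ring [S] with quotient field [K] is
   [K^* / S^*]; the clauses say that the map induced by inclusion is well
   defined, injective and surjective. *)
Definition same_value_group : Prop :=
  [/\ {subset units_of U <= units_of V},
      {in quotient_field U, forall x, x \in units_of V -> x \in units_of U}
    & {in quotient_field V, forall y, y != 0 ->
         exists2 x, x \in quotient_field U & x != 0 /\ y / x \in units_of V}].

(* Likewise for the map induced by inclusion between the residue fields
   [U / nonunits_of U] and [V / nonunits_of V]. *)
Definition same_residue_field : Prop :=
  [/\ {subset nonunits_of U <= nonunits_of V},
      {in U, forall x, x \in nonunits_of V -> x \in nonunits_of U}
    & {in V, forall y, exists2 x, x \in U & y - x \in nonunits_of V}].

Definition immediate_extension : Prop :=
  [/\ {subset U <= V}, same_value_group & same_residue_field].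

Definition algebraic_over_quotient_field : Prop :=
  forall z : F, algebraicOver (val : quotient_field_type U -> F) z.

End Extensions.

Definition generated_subfield (F : fieldType) (G : {pred F}) : {pred F} :=
  fun x => `[< forall K : divringClosed F, {subset G <= K} -> x \in K >].

Definition pth_powers (F : fieldType) (p : nat) : {pred F} :=
  fun x => `[< exists y, x = y ^+ p >].

(* Main.v *)
From HB Require Import structures.
Require Import Defs.
From mathcomp Require Import all_boot all_order all_algebra ring_quotient.
From mathcomp Require Import ring zify.
From mathcomp Require Import boolp classical_sets.

Set Implicit Arguments.
Unset Strict Implicit.
Unset Printing Implicit Defensive.

Import Order.TTheory GRing.Theory Num.Theory.
Local Open Scope ring_scope.

(** Both alternatives of the second condition say the same thing: the field [F]
    carries a nonzero derivation that vanishes on the quotient field [Q] of [U].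
    Fix [t] in [U] generating the maximal ideals of [U] and of [V].

    From a derivation to a ring.  Let [D] be such a derivation and let [R]
    consist of the [x] in [V] with [D x] in [V].  Immediacy makes [V] the sum of
    [U] and [t ^+ n * V] for every [n], so elements of [V] that are arbitrarily
    small can have any prescribed derivative in [Q] ([preimage_small]).
    Therefore [R / t ^+ n * R] is the ring of dual numbers over
    [V / t ^+ n * V], and the completion of [R] is the ring of dual numbers over
    the completion of [V].  A sequence [s n] with [s n] in [t ^+ n * V] and
    [D (s n) = 1] converges in it to the nilpotent element
    ([twisted_ramified]).  The other properties of [R] are elementary:
    [(x - u) ^+ 2] is in [R] when [u] in [U] is close to [x] in [V], so [V] is
    integral over [R] ([twisted_normalization]), and every ideal of [R] is
    generated by three elements ([twisted_noetherian]).  The derivation itself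
    is obtained by Zorn's lemma ([derivation_exists]): a derivation from a
    subring of [F] to [F] is a subring of the dual numbers over [F] that
    contains no nonzero multiple of the infinitesimal, and such a subring can be
    enlarged as long as it does not project onto [F].

    From a ring to the second condition.  Let [R] be as in the first condition
    and suppose that the second one fails.  A nilpotent element of the
    completion of [R] comes from elements of [R] that tend to 0 in [V] but not
    for the [t]-adic topology of [R].  Now [R / t * R] is spanned over [U] by
    some number [l] of elements, and every element of [V] is integral over [R]
    of degree at most [l] ([integral_deg_bound]); hence [y ^+ l] is in
    [t ^+ n * R] whenever [y] in [R] lies in [t ^+ n * V] ([pow_div_mem]).  So
    the closure [E] of [Q] in [F], for the topology given by the [t ^+ n * R],
    which is a subfield ([Qclosure_divring]), is close to being all of [F]: each
    [x] in [F] is the limit in [V] of elements [q] of [Q], and then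
    [(x - q) ^+ l] tends to 0 in [R].  In characteristic [p] this puts a power
    [x ^+ (p ^ e)] with a fixed [e] in [E], and since [F] is generated by [Q]
    and the [p]-th powers, [E] is [F] ([Qclosure_pchar]).  In characteristic 0
    every [x] is a simple root of a polynomial over [U], and Taylor's formula
    lowers the exponent [l] down to 1 ([Qclosure_pchar0]).  Once [Q] is dense
    in [F], [R] is equal to [V] ([Qclosure_full]), and a discrete valuation ring
    has no nilpotents in its completion ([dvr_not_ramified]). *)

(** * Immediate extensions of discrete valuation rings *)

(** What the proof uses of the two valuations.  The valuations themselves are
    replaced by the filtration of [F] by the [t ^+ n * V], membership in which
    is written [x / t ^+ n \in V]; the generator [t] of the maximal ideal of
    [U] also generates that of [V]. *)
Record immediate_at (F : fieldType) (U V : subringClosed F) (t : F) : Prop :=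
  ImmediateAt {
    imm_sub : {subset U <= V};
    imm_t : t \in U;
    imm_tV : t^-1 \notin V;
    imm_frac : forall x, exists n, x * t ^+ n \in V;
    imm_ord : forall x, x != 0 -> x \in V -> exists n, x / t ^+ n \in units_of V;
    imm_int : {in quotient_field U, forall x, x \in V -> x \in U};
    imm_dense : {in V, forall y, exists2 u, u \in U & (y - u) / t \in V} }.

Lemma dvr_mem_or_inv (F : fieldType) (S : subringClosed F) x :
  dvr S -> x \in quotient_field S -> x \in S \/ x^-1 \in S.
Proof.
move=> [v [vM _ _] memS] Qx.
have [->|x0] := eqVneq x 0; first by left; rewrite rpred0.
have Qx' : x^-1 \in quotient_field S by rewrite rpredV.
have Q1 : 1 \in quotient_field S by rewrite rpred1.
have v1 : v 1 = 0.
  by have := vM 1 1 Q1 Q1 (oner_neq0 _) (oner_neq0 _); rewrite mulr1; lia.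
have vV : v x + v x^-1 = 0.
  by rewrite -vM ?invr_eq0 // divff.
rewrite !memS // invr_eq0 (negbTE x0) /=.
by have [?|?] := lerP 0 (v x); [left | right; lia].
Qed.

(** Equality of the value groups gives [t] in [Q] with value 1 for the valuation
    of [V].  That [t] is in [U], like every element of [Q] in [V], comes from
    [U] being a valuation ring: otherwise its inverse would be in [U], hence it
    would be a unit of [V], hence of [U]. *)
Lemma immediate_atP (F : fieldType) (U V : subringClosed F) :
  dvr U -> dvr V -> quotient_field V =i predT -> immediate_extension U V ->
  exists t, immediate_at U V t.
Proof.
move=> dU [v [vM vD vsurj] memV] fracV [UV [uUV uVU vgV] [rUV rVU rf]].
have QT x : x \in quotient_field V by rewrite fracV.
have {}vM x y : x != 0 -> y != 0 -> v (x * y) = v x + v y by apply: vM.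
have {}memV x : (x \in V) = (x == 0) || (0 <= v x) by apply: memV.
have v1 : v 1 = 0.
  by have := vM 1 1 (oner_neq0 _) (oner_neq0 _); rewrite mulr1; lia.
have vV x : x != 0 -> v x^-1 = - v x.
  move=> x0; have : v x + v x^-1 = 0 by rewrite -vM ?invr_eq0 // divff.
  lia.
have unitV x : (x \in units_of V) = (x != 0) && (v x == 0).
  rewrite inE /= !memV invr_eq0.
  have [->|x0] //= := eqVneq x 0.
  by rewrite vV //; lia.
have [y _ [y0 vy]] := vsurj 1.
have [t Qt [t0]] := vgV _ (QT y) y0.
rewrite unitV vM ?invr_eq0 // vV // => /andP[_ /eqP vt].
have {y0 vy}vt : v t = 1 by lia.
have vX n : v (t ^+ n) = n%:Z.
  elim: n => [|n IH]; first by rewrite expr0.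
  by rewrite exprS vM ?expf_neq0 // IH vt; lia.
have int x : x \in quotient_field U -> x \in V -> x \in U.
  move=> Qx Vx; have [//|Ux'] := dvr_mem_or_inv dU Qx.
  have [->|x0] := eqVneq x 0; first by rewrite rpred0.
  have : x \in units_of V by apply/and3P; split=> //; apply: UV.
  by move=> /(uVU _ Qx) /and3P[].
exists t; split=> //.
- by apply: int => //; rewrite memV vt orbT.
- by rewrite memV invr_eq0 (negbTE t0) vV // vt.
- move=> x; have [->|x0] := eqVneq x 0; first by exists 0%N; rewrite mul0r rpred0.
  exists `|v x|%N; rewrite memV vM ?expf_neq0 // vX; apply/orP; right; lia.
- move=> x x0; rewrite memV (negbTE x0) /= => vx.
  exists `|v x|%N; rewrite unitV mulf_neq0 ?invr_eq0 ?expf_neq0 //=.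
  by rewrite vM ?invr_eq0 ?expf_neq0 // vV ?expf_neq0 // vX; apply/eqP; lia.
- move=> x Vx; have [u Uu Hu] := rf _ Vx; exists u => //; move: Hu.
  rewrite inE /= unitV !memV.
  have [->|z0] := eqVneq (x - u) 0; first by rewrite mul0r eqxx.
  rewrite /= mulf_eq0 invr_eq0 (negbTE z0) => /andP[? ?]; apply/orP; right.
  by rewrite vM ?invr_eq0 // vV // vt; lia.
Qed.

Section Immediate.
Variables (F : fieldType) (U V : subringClosed F) (t : F).
Hypothesis imm : immediate_at U V t.

Let UV : {subset U <= V} := imm_sub imm.
Let tU : t \in U := imm_t imm.
Let tV : t \in V := UV tU.

Lemma imm_t0 : t != 0.
Proof. by apply: contraNneq (imm_tV imm) => ->; rewrite invr0 rpred0. Qed.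
Let t0 := imm_t0.

Lemma imm_tX0 n : t ^+ n != 0. Proof. exact: expf_neq0. Qed.

Lemma imm_divS n x : x / t ^+ n.+1 \in V -> x / t ^+ n \in V.
Proof.
move=> h; have -> : x / t ^+ n = t * (x / t ^+ n.+1).
  by rewrite exprS invfM mulrCA mulVKf.
by rewrite rpredM.
Qed.

Lemma imm_div_le m n x : (m <= n)%N -> x / t ^+ n \in V -> x / t ^+ m \in V.
Proof.
move=> /subnK <-; elim: (n - m)%N => // k IH; rewrite addSn => /imm_divS; exact: IH.
Qed.

Lemma imm_div_mem n x : x / t ^+ n \in V -> x \in V.
Proof. by move/(imm_div_le (leq0n n)); rewrite expr0 divr1. Qed.

Lemma imm_unit_or x : x \in V -> x \in units_of V \/ x / t \in V.
Proof.
move=> Vx; have [->|x0] := eqVneq x 0; first by right; rewrite mul0r rpred0.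
have [[|n] /[dup]ux /and3P[_ Vxn _]] := imm_ord imm x0 Vx.
  by left; move: ux; rewrite expr0 divr1.
by right; rewrite -[t]expr1; apply: imm_div_le Vxn.
Qed.

Lemma imm_unitN x : x \in units_of V -> x / t \notin V.
Proof.
move=> /and3P[x0 _ Vx']; apply: contra (imm_tV imm) => h.
by rewrite -(mulKf x0 t^-1) rpredM.
Qed.

Lemma imm_unitD x y : x \in units_of V -> y / t \in V -> x + y \in units_of V.
Proof.
move=> ux Vy; have Vxy : x + y \in V.
  by case/and3P: ux => _ Vx _; rewrite rpredD // (@imm_div_mem 1) ?expr1.
have [//|h] := imm_unit_or Vxy.
case/negP: (imm_unitN ux); have -> : x / t = (x + y) / t - y / t.
  by rewrite -mulrBl addrK.
exact: rpredB.
Qed.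

Lemma imm_unit1 : 1 \in units_of V.
Proof. by apply/and3P; rewrite invr1 oner_neq0 rpred1. Qed.

Lemma imm_U_frac x : x \in U -> x \in quotient_field U.
Proof.
by move=> Ux; apply/asboolP; exists x, 1; rewrite divr1 rpred1 oner_neq0.
Qed.

Lemma imm_tX_frac n : t ^+ n \in quotient_field U.
Proof. by rewrite rpredX ?imm_U_frac. Qed.

Lemma imm_U_div n x : x \in U -> x / t ^+ n \in V -> x / t ^+ n \in U.
Proof. by move=> Ux; apply: (imm_int imm); rewrite rpred_div ?imm_tX_frac ?imm_U_frac. Qed.

(** Equality of the residue fields gives the approximation modulo [t], which is
    then repeated on the remainder divided by a power of [t]. *)
Lemma imm_approx n : {in V, forall y, exists2 u, u \in U & (y - u) / t ^+ n \in V}.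
Proof.
elim: n => [|n IH] y Vy; first by exists 0; rewrite ?rpred0 // subr0 expr0 divr1.
have [u Uu Vu] := IH _ Vy; have [w Uw Vw] := imm_dense imm Vu.
exists (u + t ^+ n * w); first by rewrite rpredD ?rpredM ?rpredX.
have -> : (y - (u + t ^+ n * w)) / t ^+ n.+1 = ((y - u) / t ^+ n - w) / t.
  by rewrite exprS; field; rewrite t0 imm_tX0.
by [].
Qed.

Lemma imm_approx_frac n y : exists2 q, q \in quotient_field U & (y - q) / t ^+ n \in V.
Proof.
have [m Vm] := imm_frac imm y; have [u Uu Vu] := imm_approx (n + m) Vm.
exists (u / t ^+ m); first by rewrite rpred_div ?imm_tX_frac ?imm_U_frac.
have -> : (y - u / t ^+ m) / t ^+ n = (y * t ^+ m - u) / t ^+ (n + m).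
  by rewrite exprD; field; rewrite !imm_tX0.
by [].
Qed.

End Immediate.

Lemma imm_val (F : fieldType) (U V : subringClosed F) (t : F) :
  immediate_at U V t -> forall x, x \in V \/ x^-1 \in V.
Proof.
move=> imm x; have [->|x0] := eqVneq x 0; first by left; rewrite rpred0.
have t0 := imm_t0 imm; have tV := imm_sub imm (imm_t imm).
have [n Vn] := imm_frac imm x.
have [|m] := imm_ord imm _ Vn; first by rewrite mulf_neq0 ?expf_neq0.
move=> /and3P[_ Vm Vm']; have [le|/ltnW le] := leqP n m; [left | right].
- have -> : x = x * t ^+ n / t ^+ m * t ^+ (m - n).
    by rewrite -{1}(subnK le) exprD; field; rewrite !expf_neq0.
  by rewrite rpredM ?rpredX.
- have -> : x^-1 = (x * t ^+ n / t ^+ m)^-1 * t ^+ (n - m).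
    by rewrite -{1}(subnK le) exprD; field; rewrite x0 !expf_neq0.
  by rewrite rpredM ?rpredX.
Qed.

(** * Spans and integrality over a subring *)

(** Defined by recursion on the generators, so that the closure properties below
    are plain inductions; [span_sum] recovers the coefficients. *)
Fixpoint span_over (F : fieldType) (A : {pred F}) (S : seq F) (x : F) : Prop :=
  if S is s :: S' then exists2 a, a \in A & span_over A S' (x - a * s) else x = 0.

Section Span.
Variables (F : fieldType) (A : subringClosed F).

Lemma span0 S : span_over A S 0.
Proof.
by elim: S => //= s S IH; exists 0; rewrite ?rpred0 // mul0r subrr.
Qed.

Lemma span_cat S T x y : span_over A S x -> span_over A T y -> span_over A (S ++ T) (x + y).
Proof.
elim: S x => [|s S IH] x /=; first by move=> ->; rewrite add0r.
by case=> a Aa hx hy; exists a; rewrite // addrAC; apply: IH.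
Qed.

Lemma spanM S x g : span_over A S x -> span_over A [seq s * g | s <- S] (x * g).
Proof.
elim: S x => [|s S IH] x /=; first by move=> ->; rewrite mul0r.
by case=> a Aa /IH h; exists a; rewrite // mulrA -mulrBl.
Qed.

Lemma spanD S x y : span_over A S x -> span_over A S y -> span_over A S (x + y).
Proof.
elim: S x y => [|s S IH] x y /=; first by move=> -> ->; rewrite addr0.
case=> a Aa hx [b Ab hy]; exists (a + b); first exact: rpredD.
by rewrite mulrDl opprD addrACA; apply: IH.
Qed.

Lemma spanZ S x a : a \in A -> span_over A S x -> span_over A S (a * x).
Proof.
move=> Aa; elim: S x => [|s S IH] x /=; first by move=> ->; rewrite mulr0.
by case=> b Ab hx; exists (a * b); rewrite ?rpredM // -mulrA -mulrBr; apply: IH.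
Qed.

Lemma span_sum S x : span_over A S x ->
  exists2 a : nat -> F, forall i, a i \in A & x = \sum_(i < size S) a i * S`_i.
Proof.
elim: S x => [|s S IH] x /=.
  by move=> ->; exists (fun=> 0) => [i|]; rewrite ?rpred0 // big_ord0.
case=> b Ab /IH[a Aa ax]; exists (fun i => if i is j.+1 then a j else b).
  by case.
by rewrite big_ord_recl /= -ax addrC subrK.
Qed.

Lemma span_mem S g : g \in S -> span_over A S g.
Proof.
elim: S => //= s S IH; rewrite inE => /orP[/eqP<-|/IH h].
  by exists 1; rewrite ?rpred1 // mul1r subrr; apply: span0.
by exists 0; rewrite ?rpred0 // mul0r subr0.
Qed.

End Span.

Definition integral_deg (F : fieldType) (R : {pred F}) (n : nat) (x : F) : Prop :=
  exists2 r : nat -> F, forall i, r i \in R & x ^+ n = \sum_(i < n) r i * x ^+ i.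

Lemma integralOver_deg (F : fieldType) (R : subringClosed F) x :
  integralOver (val : subring_type R -> F) x -> exists n, integral_deg R n x.
Proof.
case=> p /monicP pm /rootP; rewrite horner_coef size_map_inj_poly //; last exact: val_inj.
have : size p != 0%N.
  by rewrite size_poly_eq0 -lead_coef_eq0 pm oner_neq0.
case E: (size p) => [//|n] _; rewrite big_ord_recr /= coef_map_id0 ?rmorph0 //=.
have -> : p`_n = 1 by rewrite -pm lead_coefE E.
rewrite mul1r => /eqP; rewrite addrC addr_eq0 => /eqP h.
exists n; exists (fun i => - val p`_i) => [i|]; first by rewrite rpredN; apply: valP.
by rewrite h -sumrN; apply: eq_bigr => i _; rewrite coef_map_id0 ?rmorph0 // mulNr.
Qed.

(** Multiply an integral equation of [a / b] by [b ^+ n.-1].  With [a := 1] this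
    says that an integral inverse already lies in [R]; with [b] a uniformizer,
    that elements of the maximal ideal have a power divisible by it. *)
Lemma integral_deg_div (F : fieldType) (R : subringClosed F) n a b :
  a \in R -> b \in R -> b != 0 -> integral_deg R n (a / b) -> a ^+ n / b \in R.
Proof.
move=> Ra Rb b0 [r Rr]; case: n => [|n].
  by rewrite big_ord0 expr0 => /eqP; rewrite oner_eq0.
move=> h; have -> : a ^+ n.+1 / b = (a / b) ^+ n.+1 * b ^+ n.
  by rewrite expr_div_n !exprS; field; rewrite b0 expf_neq0.
rewrite h mulr_suml; apply: rpred_sum => i _.
have -> : r i * (a / b) ^+ i * b ^+ n = r i * (a ^+ i * b ^+ (n - i)).
  have -> : b ^+ n = b ^+ (n - i) * b ^+ i by rewrite -exprD subnK ?(ltnSE (ltn_ord i)).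
  by rewrite expr_div_n; field; rewrite expf_neq0.
by rewrite !rpredM ?rpredX.
Qed.

Lemma horner_taylor2 (F : fieldType) (R : subringClosed F) (p : {poly F}) u z :
  p \is a polyOver R -> u \in R -> z \in R ->
  exists2 h, h \in R & p.[u + z] = p.[u] + p^`().[u] * z + z ^+ 2 * h.
Proof.
move=> Rp Ru Rz; elim/poly_ind: p Rp => [|p c IH] Rp.
  by exists 0; rewrite ?rpred0 // derivC !horner0; ring.
have Rp' : p \is a polyOver R.
  apply/polyOverP => i; move/polyOverP: Rp => /(_ i.+1).
  by rewrite coefD coefMX coefC /= addr0.
have [h Rh hE] := IH Rp'; exists (h * (u + z) + p^`().[u]).
  rewrite rpredD // ?rpredM ?rpredD // rpred_horner // polyOver_deriv //.
by rewrite derivMXaddC hornerD hornerM !hornerMXaddC hornerX hE; ring.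
Qed.

(** * Rings between U and V with normalization V *)

Section Intermediate.
Variables (F : fieldType) (U V R : subringClosed F) (t : F).
Hypothesis imm : immediate_at U V t.
Hypothesis UR : {subset U <= R}.
Hypothesis RV : {subset R <= V}.
Hypothesis intR : {in V, forall x, exists n, integral_deg R n x}.
Hypothesis fracR : forall x, x \in quotient_field R.

Let t0 : t != 0 := imm_t0 imm.
Let tX0 n : t ^+ n != 0 := imm_tX0 imm n.
Let tU : t \in U := imm_t imm.
Let tR : t \in R := UR tU.
Local Notation Q := (quotient_field U).

Lemma integral_inv_mem x : x \in R -> x \in units_of V -> x^-1 \in R.
Proof.
move=> Rx /and3P[x0 Vx /intR[n]]; rewrite -div1r => h.
by rewrite -[1](expr1n _ n) (integral_deg_div _ _ _ h) ?rpred1.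
Qed.

Lemma nonunit_pow_div_t x : x \in R -> x / t \in V -> exists n, x ^+ n / t \in R.
Proof. by move=> Rx /intR[n h]; exists n; apply: integral_deg_div h. Qed.

Lemma mul_tX_le m n x : (m <= n)%N -> x * t ^+ m \in R -> x * t ^+ n \in R.
Proof. by move=> le h; rewrite -(subnKC le) exprD mulrA rpredM ?rpredX. Qed.

(** [R] becomes [F] when [t] is inverted: for [b] nonzero in [R], some
    [t ^+ k / b] is in [V], hence is integral over [R]. *)
Lemma mul_tX_mem x : exists c, x * t ^+ c \in R.
Proof.
have /asboolP[a [b [Ra Rb b0 ->]]] := fracR x.
have [k] := imm_frac imm b^-1; rewrite mulrC => /intR[n h].
exists (k * n)%N; rewrite -mulrA rpredM // mulrC exprM.
by apply: integral_deg_div h; rewrite ?rpredX.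
Qed.

Lemma mul_tX_mem_seq (b : nat -> F) n :
  exists c, forall i, (i < n)%N -> b i * t ^+ c \in R.
Proof.
elim: n => [|n [c hc]]; first by exists 0%N.
have [d hd] := mul_tX_mem (b n); exists (maxn c d) => i.
rewrite ltnS leq_eqVlt => /orP[/eqP->|/hc].
  by apply: mul_tX_le hd; rewrite leq_maxr.
by apply: mul_tX_le; rewrite leq_maxl.
Qed.

(** Let [G] generate the maximal ideal of [R].  Since [R] is the sum of [U] and
    that ideal, [R] is spanned by 1 modulo the ideal generated by [t] and [G].
    A generator [g] is then removed from the ideal at the cost of multiplying
    the spanning family by the powers [1, g, ..., g ^+ e.-1], where [g ^+ e] is
    a multiple of [t]. *)
Lemma finite_mod_t (G : seq F) :
  {in G, forall g, g \in R /\ g / t \in V} ->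
  (forall x, x \in R -> x / t \in V -> span_over R G x) ->
  exists2 S, {subset S <= R} &
    forall x, x \in R -> exists2 y, y \in R & span_over U S (x - t * y).
Proof.
move=> GR Ggen.
suff H T : {in T, forall g, g \in R /\ g / t \in V} ->
    (exists2 S, {subset S <= R} & forall x, x \in R ->
       exists2 y, span_over R (t :: T) y & span_over U S (x - y)) ->
    exists2 S, {subset S <= R} &
      forall x, x \in R -> exists2 y, y \in R & span_over U S (x - t * y).
  apply: (H G) => //; exists [:: 1] => [x|x Rx]; first by rewrite inE => /eqP->; rewrite rpred1.
  have [u Uu Vu] := imm_dense imm (RV Rx); exists (x - u).
    exists 0; rewrite ?rpred0 // mul0r subr0.
    by apply: Ggen => //; apply: rpredB => //; apply: UR.
  by exists u => //=; ring.
elim: T => [|g T IH] gT [S SR hS].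
  exists S => // x Rx; have [y [a Ra /eqP]] := hS x Rx.
  by rewrite subr_eq0 => /eqP-> ?; exists a; rewrite // mulrC.
apply: IH => [h hT|]; first by apply: gT; rewrite inE hT orbT.
have [Rg Vg] : g \in R /\ g / t \in V by apply: gT; rewrite mem_head.
suff K k : exists2 S, {subset S <= R} & forall x, x \in R -> exists y r,
    [/\ r \in R, span_over R (t :: T) y & span_over U S (x - y - r * g ^+ k)].
  have [e Re] := nonunit_pow_div_t Rg Vg; have [S' S'R hS'] := K e; exists S' => // x Rx.
  have [y [r [Rr hy hx]]] := hS' x Rx.
  exists (y + r * g ^+ e); last by rewrite opprD addrA.
  have -> : r * g ^+ e = r * (g ^+ e / t) * t by field.
  case: hy => a Ra hy; exists (a + r * (g ^+ e / t)).
    by apply: rpredD => //; apply: rpredM.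
  by rewrite mulrDl opprD addrACA subrr addr0.
elim: k => [|k [S' S'R hS']].
  exists [::] => // x Rx; exists 0, x; split=> //=; last by rewrite mulr1 subr0 subrr.
  exists 0; rewrite ?rpred0 // mul0r subrr.
  exact: span0.
exists (S' ++ [seq s * g ^+ k | s <- S]) => [x|x Rx].
  rewrite mem_cat => /orP[/S'R//|/mapP[s sS ->]].
  by apply: rpredM; [apply: SR | apply: rpredX].
have [y [r [Rr hy hx]]] := hS' x Rx.
have [z [a Ra [b Rb hz]] hr] := hS r Rr.
exists (y + g ^+ k * (z - b * g)), b; split=> //.
  case: hy => c Rc hy; exists (c + g ^+ k * a).
    by apply: rpredD => //; apply: rpredM => //; apply: rpredX.
  have -> : y + g ^+ k * (z - b * g) - (c + g ^+ k * a) * t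
      = (y - c * t) + g ^+ k * (z - a * t - b * g) by ring.
  by apply: spanD => //; apply: spanZ => //; rewrite rpredX.
have -> : x - (y + g ^+ k * (z - b * g)) - b * g ^+ k.+1
    = x - y - r * g ^+ k + (r - z) * g ^+ k by rewrite exprS; ring.
exact: span_cat (spanM _ hr).
Qed.

Section Rank.
Variable S : seq F.
Hypothesis SR : {subset S <= R}.
Hypothesis Sgen :
  forall x, x \in R -> exists2 y, y \in R & span_over U S (x - t * y).
Local Notation l := (size S).

Lemma Sgen_tX n x : x \in R -> exists2 y, y \in R & span_over U S (x - t ^+ n * y).
Proof.
elim: n x => [|n IH] x Rx.
  by exists x => //; rewrite mul1r subrr; apply: span0.
have [y Ry hy] := IH x Rx; have [z Rz hz] := Sgen Ry; exists z => //.
have -> : x - t ^+ n.+1 * z = (x - t ^+ n * y) + t ^+ n * (y - t * z).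
  by rewrite exprSr; ring.
by apply: spanD => //; apply: spanZ => //; rewrite rpredX.
Qed.


Lemma max_value (s : seq F) : has (fun x => x != 0) s ->
  exists2 z, z \in s /\ z != 0 & {in s, forall y, y / z \in V}.
Proof.
elim: s => //= x s IH; have [/IH[z [sz z0] zs] _|h] := boolP (has _ s).
  have [Vxz|] := imm_val imm (x / z).
    exists z; first by rewrite inE sz orbT.
    by move=> y; rewrite inE => /orP[/eqP->|/zs].
  rewrite invf_div => Vzx; have [x0|x0] := eqVneq x 0.
    exists z; first by rewrite inE sz orbT.
    by move=> y; rewrite inE => /orP[/eqP->|/zs//]; rewrite x0 mul0r rpred0.
  exists x; first by rewrite mem_head.
  move=> y; rewrite inE => /orP[/eqP->|/zs Vyz]; first by rewrite divff ?rpred1.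
  by rewrite -(divfK z0 y) -mulrA rpredM.
rewrite orbF => x0; exists x; first by rewrite mem_head.
move=> y; rewrite inE => /orP[/eqP->|sy]; first by rewrite divff ?rpred1.
by have /hasPn/(_ y sy) := h; rewrite negbK => /eqP->; rewrite mul0r rpred0.
Qed.

(** Modulo a high power of [t], the [l.+1] elements [b i], once scaled into [R],
    are combinations of the [l] elements of [S].  The matrix of coefficients has
    a nonzero left kernel vector, which is scaled so that its entries are in
    [V] and one of them is 1, and then approximated by entries in [U]. *)
Lemma primitive_relation (b : nat -> F) :
  exists u : nat -> F, [/\ forall i, u i \in U,
    exists2 i, (i < l.+1)%N & u i = 1 & (\sum_(i < l.+1) u i * b i) / t \in R].
Proof.
have [c hc] := mul_tX_mem_seq b l.+1.
have /choice[y hy] (i : 'I_l.+1) : exists y : F * (nat -> F),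
    [/\ y.1 \in R, forall j, y.2 j \in U &
      b i * t ^+ c = t ^+ c.+1 * y.1 + \sum_(j < l) y.2 j * S`_j].
  (* One power of [t] more than the scaling, so that a factor [t] is left. *)
  have [y Ry /span_sum[a Ua ha]] := Sgen_tX c.+1 (hc i (ltn_ord i)).
  by exists (y, a); split; rewrite //= -ha addrC subrK.
pose A := \matrix_(i < l.+1, j < l) (y i).2 j.
have /rowV0Pn[w /sub_kermxP wA w0] : kermx A != 0.
  by rewrite kermx_eq0 /row_free neq_ltn ltnS rank_leq_col.
have [|z [/mapP[i0 _ ->] wi0] hz] := @max_value [seq w 0 i | i <- enum 'I_l.+1].
  apply/hasP; have /existsP[i hi] : [exists i, w 0 i != 0].
    apply: contraNT w0; rewrite negb_exists => /forallP h.
    by apply/eqP/rowP => i; rewrite mxE; apply/eqP; have := h i; rewrite negbK.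
  by exists (w 0 i); rewrite // map_f ?mem_enum.
have {}hz i : w 0 i / w 0 i0 \in V by apply: hz; rewrite map_f ?mem_enum.
have /choice[u hu] (i : 'I_l.+1) : exists u : F,
    [/\ u \in U, i = i0 -> u = 1 & (u - w 0 i / w 0 i0) / t ^+ c.+1 \in V].
  have [->|ne] := eqVneq i i0.
    by exists 1; rewrite rpred1 divff // subrr mul0r rpred0.
  have [u Uu Vu] := imm_approx imm c.+1 (hz i); exists u; split=> //.
    by move=> e; rewrite e eqxx in ne.
  by rewrite -rpredN -mulNr opprB.
have {}hu i := let: And3 h1 h2 h3 := hu i in (h1, h2, h3).
pose u' i := oapp u 0 (insub i : option 'I_l.+1).
have u'E (i : 'I_l.+1) : u' i = u i by rewrite /u' valK.
exists u'; split.
- by move=> i; rewrite /u'; case: insubP => [j _ _|_] /=; [apply: (hu j).1.1 | apply: rpred0].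
- by exists i0; rewrite // u'E; apply: (hu i0).1.2.
(* The exact kernel vector would give 0; the approximation gives an element of
   [t ^+ c.+1 * V] that is also in [U], hence is divisible in [U]. *)
have col j : (j < l)%N -> (\sum_i u i * (y i).2 j) / t ^+ c.+1 \in R.
  move=> lj; apply/UR/(imm_U_div imm).
    by apply: rpred_sum => i _; apply: rpredM; [apply: (hu i).1.1 | case: (hy i)].
  have -> : \sum_i u i * (y i).2 j = \sum_i (u i - w 0 i / w 0 i0) * (y i).2 j.
    apply/eqP; rewrite -subr_eq0 -sumrB.
    rewrite (eq_bigr (fun i => (w 0 i0)^-1 * (w 0 i * A i (Ordinal lj)))).
      by rewrite -mulr_sumr; have /rowP/(_ (Ordinal lj)) := wA; rewrite !mxE => ->; rewrite mulr0.
    by move=> i _; rewrite mxE /=; ring.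
  rewrite mulr_suml; apply: rpred_sum => i _; rewrite mulrAC; apply: rpredM.
    exact: (hu i).2.
  by apply: (imm_sub imm); case: (hy i).
have -> : (\sum_(i < l.+1) u' i * b i) / t
   = \sum_(i < l.+1) u i * (y i).1
     + \sum_(j < l) (\sum_i u i * (y i).2 j) / t ^+ c.+1 * S`_j.
  apply: (mulIf (tX0 c.+1)); rewrite exprS mulrA mulfVK // -exprS mulr_suml mulrDl.
  rewrite (eq_bigr (fun i => u i * (y i).1 * t ^+ c.+1 + u i * \sum_(j < l) (y i).2 j * S`_j)).
    rewrite big_split /= mulr_suml; congr (_ + _).
    under eq_bigr do rewrite mulr_sumr.
    rewrite exchange_big /= mulr_suml; apply: eq_bigr => j _.
    rewrite mulrAC mulfVK // mulr_suml; apply: eq_bigr => i _; exact: mulrA.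
  move=> i _; rewrite u'E -[LHS]mulrA; have [_ _ hi] := hy i; rewrite hi.
  by rewrite mulrDr [t ^+ _ * _]mulrC mulrA.
apply: rpredD; apply: rpred_sum => i _; apply: rpredM.
- exact/UR/(hu i).1.1.
- by case: (hy i).
- exact: col.
- by apply: SR; rewrite mem_nth.
Qed.

(** The [R]-module spanned by the powers of [v] with exponent less than [n]. *)
Definition poly_values (v : F) (n : nat) (x : F) : Prop :=
  exists p : {poly F}, [/\ p \is a polyOver R, (size p <= n)%N & x = p.[v]].

Lemma poly_valuesD v n x y : poly_values v n x -> poly_values v n y -> poly_values v n (x + y).
Proof.
move=> [p [Rp sp ->]] [q [Rq sq ->]]; exists (p + q); split.
- exact: rpredD.
- by rewrite (leq_trans (size_polyD _ _)) // geq_max sp.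
- by rewrite hornerD.
Qed.

Lemma poly_valuesZ v n a x : a \in R -> poly_values v n x -> poly_values v n (a * x).
Proof.
move=> Ra [p [Rp sp ->]]; exists (a *: p); split.
- exact: polyOverZ.
- exact: leq_trans (size_scale_leq _ _) sp.
- by rewrite hornerZ.
Qed.

Lemma poly_values_le v m n x : (m <= n)%N -> poly_values v m x -> poly_values v n x.
Proof. by move=> le [p [Rp sp ->]]; exists p; split; rewrite // (leq_trans sp). Qed.

Lemma poly_values_const v n a : a \in R -> (0 < n)%N -> poly_values v n a.
Proof.
move=> Ra n0; exists a%:P; split; rewrite ?polyOverC ?hornerC //.
exact: leq_trans (size_polyC_leq1 _) n0.
Qed.

Lemma poly_valuesX v n : poly_values v n.+1 (v ^+ n).
Proof. by exists 'X^n; rewrite hornerXn size_polyXn rpredX ?polyOverX. Qed.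

Lemma poly_values0 v n : poly_values v n 0.
Proof. by exists 0; rewrite horner0 size_poly0 rpred0. Qed.

Lemma poly_values_sum v n m (a : nat -> F) :
  (forall i, (i < m)%N -> a i \in R) -> (m <= n)%N ->
  poly_values v n (\sum_(i < m) a i * v ^+ i).
Proof.
move=> Ra le; elim/big_ind: _ => [||i _]; first exact: poly_values0.
  exact: poly_valuesD.
apply: poly_valuesZ; first exact: Ra.
exact: poly_values_le (leq_trans (ltn_ord i) le) (poly_valuesX _ _).
Qed.

Lemma poly_values_deg v n : poly_values v n (v ^+ n) -> integral_deg R n v.
Proof.
case=> p [/polyOverP Rp sp hp]; exists (fun i => p`_i) => //.
by rewrite hp; exact: horner_coef_wide.
Qed.

Lemma poly_values_bounded v n : integral_deg R n v ->
  exists c, forall m x, poly_values v m x -> x * t ^+ c \in R.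
Proof.
case=> r Rr hv; have [c hc] := mul_tX_mem_seq (fun i => v ^+ i) n.
exists c => m x [p [/polyOverP Rp _ ->]]; rewrite horner_coef mulr_suml.
apply: rpred_sum => i _; rewrite -mulrA; apply: rpredM => //.
move: (nat_of_ord i) => {i p Rp}; elim/ltn_ind => i IH.
have [|le] := ltnP i n; first exact: hc.
rewrite -(subnK le) exprD hv mulr_sumr mulr_suml; apply: rpred_sum => j _.
have -> : v ^+ (i - n) * (r j * v ^+ j) * t ^+ c = r j * (v ^+ (i - n + j) * t ^+ c).
  by rewrite exprD; ring.
apply: rpredM => //; apply: IH.
by rewrite -{2}(subnK le) ltn_add2l.
Qed.

(** A relation from [primitive_relation] between the powers of [v] with
    exponents up to [l], solved for its last unit coefficient, reads
    [v ^+ m = a + t * b] where [a] has degree less than [m] in [v] and [b] is in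
    [R[v]].  By induction on degrees [R[v]] is the sum of
    [R + R * v + ... + R * v ^+ m.-1] and [t * R[v]].  As [v] is integral,
    [t ^+ c * R[v]] is contained in [R] for some [c], so that iterating [c]
    times, as in Nakayama's lemma, removes the second summand. *)
Lemma integral_deg_bound v : v \in V ->
  exists m, [/\ (0 < m)%N, (m <= l)%N & integral_deg R m v].
Proof.
move=> Vv; have [d /poly_values_bounded[c hc]] := intR Vv.
have [u [Uu [i0 i0l ui0] hu]] := primitive_relation (fun i => v ^+ i).
pose P i := (i < l.+1)%N && (u i \in units_of V).
have exP : exists i, P i by exists i0; rewrite /P i0l ui0 (imm_unit1 V).
have leP i : P i -> (i <= l)%N by case/andP.
case: (ex_maxnP exP leP) => m /andP[ml um] maxm.
have tail i : (m < i < l.+1)%N -> u i / t \in R.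
  move=> /andP[mi il]; rewrite -[t]expr1; apply/UR/(imm_U_div imm) => //.
  rewrite expr1; have [ui|//] := imm_unit_or imm (imm_sub imm (Uu i)).
  by have := maxm i; rewrite /P il ui leqNgt mi => /(_ isT).
have Rum : (u m)^-1 \in R by apply: integral_inv_mem => //; apply: UR.
have um0 : u m != 0 by case/and3P: um.
(* After the last unit coefficient all coefficients are divisible by [t], so
   that these terms go into [t * b]. *)
have rel : exists a k b, [/\ poly_values v m a, poly_values v k b & v ^+ m = a + t * b].
  exists (- ((u m)^-1 * \sum_(i < m) u i * v ^+ i)), l.+1.
  exists ((u m)^-1 * ((\sum_(i < l.+1) u i * v ^+ i) / t
            - \sum_(i < l.+1) (if (m < i)%N then u i / t else 0) * v ^+ i)).
  split.
  - rewrite -mulNr; apply: poly_valuesZ; first by rewrite rpredN.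
    by apply: poly_values_sum => // i _; apply: UR.
  - apply: poly_valuesZ => //; apply: poly_valuesD; first exact: poly_values_const.
    rewrite -mulN1r; apply: poly_valuesZ; first by rewrite rpredN1.
    apply: (@poly_values_sum v l.+1 l.+1 (fun i => if (m < i)%N then u i / t else 0)) => // i il.
    by case: ifP => [mi|_]; rewrite ?tail ?mi ?rpred0.
  have -> : t * ((u m)^-1 * ((\sum_(i < l.+1) u i * v ^+ i) / t
          - \sum_(i < l.+1) (if (m < i)%N then u i / t else 0) * v ^+ i))
    = (u m)^-1 * ((\sum_(i < l.+1) u i * v ^+ i)
          - \sum_(i < l.+1) (if (m < i)%N then u i else 0) * v ^+ i).
    rewrite mulrCA; congr (_ * _); rewrite mulrBr mulrCA divff // mulr1 mulr_sumr.
    congr (_ - _); apply: eq_bigr => i _; rewrite mulrA; congr (_ * _).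
    by case: ifP; rewrite ?mulr0 // mulrCA divff // mulr1.
  rewrite -sumrB.
  rewrite (eq_bigr (fun i : 'I_l.+1 => if (i < m.+1)%N then u i * v ^+ i else 0)); last first.
    by move=> i _; rewrite ltnS; case: (ltnP m i) => _; rewrite ?subrr // mul0r subr0.
  rewrite -big_mkcond /= -(big_ord_widen l.+1 (fun i => u i * v ^+ i)) //.
  by rewrite big_ord_recr /= mulrDr mulKf // addrA addNr add0r.
have [a [k [b [ha hb hm]]]] := rel.
have red n x : poly_values v n x ->
    exists a k b, [/\ poly_values v m a, poly_values v k b & x = a + t * b].
  move=> [p [Rp _ ->]]; elim/poly_ind: p Rp => [|p e IH] Rp.
    exists 0, 0%N, 0; split; first exact: poly_values0.
      exact: poly_values0.
    by rewrite horner0 mulr0 addr0.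
  have Re : e \in R.
    by move/polyOverP: Rp => /(_ 0%N); rewrite coefD coefMX coefC /= add0r.
  have Rp' : p \is a polyOver R.
    apply/polyOverP => i; move/polyOverP: Rp => /(_ i.+1).
    by rewrite coefD coefMX coefC /= addr0.
  have [a' [k' [b' [[q [Rq sq ->]] [q' [Rq' sq' ->]] hp]]]] := IH Rp'.
  have {}sq : (size ('X * q + e%:P)%R <= m.+1)%N.
    rewrite (leq_trans (size_polyD _ _)) // geq_max (leq_trans (size_polyC_leq1 _)) // andbT.
    by rewrite mulrC (leq_trans (size_polyMleq _ _)) // size_polyX addn2.
  pose g := 'X * q + e%:P; have Rg i : g`_i \in R.
    move: i; apply/polyOverP; rewrite /g; apply: rpredD; last by rewrite polyOverC.
    by apply: rpredM => //; apply: polyOverX.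
  exists ((\sum_(i < m) g`_i * v ^+ i) + g`_m * a).
  exists (maxn k (size q').+1), (v * q'.[v] + g`_m * b); split.
  - by apply: poly_valuesD; [exact: poly_values_sum | exact: poly_valuesZ].
  - apply: poly_valuesD; last first.
      by apply: poly_valuesZ => //; apply: poly_values_le hb; rewrite leq_maxl.
    exists ('X * q'); rewrite hornerM hornerX; split=> //.
      by rewrite rpredM ?polyOverX.
    by rewrite mulrC (leq_trans (size_polyMleq _ _)) // size_polyX addn2 leq_maxr.
  - have -> : (p * 'X + e%:P).[v] = g.[v] + t * (v * q'.[v]).
      rewrite /g hornerMXaddC hp hornerD hornerM hornerX hornerC; ring.
    by rewrite (horner_coef_wide _ sq) big_ord_recr /= -/g hm; ring.
(* Otherwise 1 would be a multiple of [t] in [V]. *)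
have m0 : (0 < m)%N.
  rewrite lt0n; apply/eqP => m0; case: ha => p [_]; rewrite m0 leqn0 size_poly_eq0.
  move=> /eqP-> a0; case: hb => q [Rq _ hb].
  have /negP := imm_unitN imm (imm_unit1 V); apply.
  have -> : 1 / t = b.
    by apply: (mulfI t0); rewrite mulrCA divff // mulr1 -(expr0 v) -m0 hm a0 horner0 add0r.
  rewrite hb; apply: rpred_horner => //.
  by apply/polyOverP => i; apply: RV; apply: (polyOverP Rq).
exists m; split=> //; apply: poly_values_deg.
have {red} pow j n x : poly_values v n x ->
    exists a k b, [/\ poly_values v m a, poly_values v k b & x = a + t ^+ j * b].
  elim: j n x => [|j IH] n x hx.
    by exists 0, n, x; split; [exact: poly_values0| done | rewrite mul1r add0r].
  have [a1 [k1 [b1 [ha1 hb1 ->]]]] := IH _ _ hx.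
  have [a2 [k2 [b2 [ha2 hb2 ->]]]] := red _ _ hb1.
  exists (a1 + t ^+ j * a2), k2, b2; split=> //; last by rewrite exprSr; ring.
  by apply: poly_valuesD => //; apply: poly_valuesZ; rewrite ?rpredX.
have [a1 [k1 [b1 [ha1 hb1 ->]]]] := pow c _ _ (poly_valuesX v m).
by apply: poly_valuesD => //; apply: poly_values_const => //; rewrite mulrC; apply: hc hb1.
Qed.

(** Multiply by [t ^+ (n * m)] an integral equation of degree [m <= l] of
    [y / t ^+ n].  The exponent [l] depends neither on [y] nor on [n]: this is
    the trace left on [R] by the nilpotency of the kernel of the map from the
    completion of [R] to that of [V]. *)
Lemma pow_div_mem y n j : (l <= j)%N -> y \in R -> y / t ^+ n \in V ->
  y ^+ j / t ^+ n \in R.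
Proof.
move=> lj Ry /integral_deg_bound[m [m0 ml [r Rr h]]].
have -> : y ^+ j / t ^+ n = y ^+ (j - m) * ((y / t ^+ n) ^+ m * t ^+ (n * m.-1)).
  rewrite -{1}(subnK (leq_trans ml lj)) exprD -mulrA; congr (_ * _).
  by rewrite expr_div_n -exprM -{3}(prednK m0) mulnS exprD invfM -mulrA mulfVK.
rewrite h; apply: rpredM; first exact: rpredX.
rewrite mulr_suml; apply: rpred_sum => i _.
have -> : r i * (y / t ^+ n) ^+ i * t ^+ (n * m.-1) = r i * (y ^+ i * t ^+ (n * (m.-1 - i))).
  have le : (n * i <= n * m.-1)%N by apply: leq_mul => //; rewrite -ltnS prednK.
  by rewrite mulnBr -{1}(subnK le) exprD expr_div_n -exprM; field.
by apply: rpredM => //; apply: rpredM; apply: rpredX.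
Qed.

End Rank.

(** * The closure of the quotient field of U *)

Section Closure.
Variable l : nat.
Hypothesis nilR : forall y n j, (l <= j)%N -> y \in R -> y / t ^+ n \in V ->
  y ^+ j / t ^+ n \in R.

Definition Qclosure : {pred F} := fun x =>
  `[< forall n, exists2 q, q \in Q & (x - q) / t ^+ n \in R >].

Lemma sub_Qclosure : {subset Q <= Qclosure}.
Proof. by move=> q Qq; apply/asboolP => n; exists q; rewrite // subrr mul0r rpred0. Qed.

Lemma inv_1Dt_mem s : s \in R -> (1 + t * s)^-1 \in R.
Proof.
move=> Rs; apply: integral_inv_mem; first by rewrite rpredD ?rpred1 ?rpredM.
by apply: (imm_unitD imm (imm_unit1 V)); rewrite mulrAC divff // mul1r RV.
Qed.

(** The [t ^+ n * R] define a field topology on [F]: products are continuous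
    because every element of [F] is in some [t ^- c * R], and inverses because
    the elements of [1 + t * R] are units of [R]. *)
Lemma Qclosure_divring : divring_closed Qclosure.
Proof.
have clB : {in Qclosure &, forall x y, x - y \in Qclosure}.
  move=> x y /asboolP hx /asboolP hy; apply/asboolP => n.
  have [q Qq Rq] := hx n; have [r Qr Rr] := hy n; exists (q - r); first exact: rpredB.
  have -> : (x - y - (q - r)) / t ^+ n = (x - q) / t ^+ n - (y - r) / t ^+ n.
    by rewrite -mulrBl; congr (_ / _); ring.
  exact: rpredB.
have clM : {in Qclosure &, forall x y, x * y \in Qclosure}.
  move=> x y /asboolP hx /asboolP hy; apply/asboolP => n.
  have [a Ra] := mul_tX_mem x; have [b Rb] := mul_tX_mem y.
  have [q Qq Rq] := hx (n + b)%N; have [r Qr Rr] := hy (n + a)%N.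
  exists (q * r); first exact: rpredM.
  have -> : (x * y - q * r) / t ^+ n
    = x * t ^+ a * ((y - r) / t ^+ (n + a)) + y * t ^+ b * ((x - q) / t ^+ (n + b))
      - t ^+ n * t ^+ a * t ^+ b * (((x - q) / t ^+ (n + b)) * ((y - r) / t ^+ (n + a))).
    by rewrite !exprD; field; rewrite !tX0.
  apply: rpredB; first by apply: rpredD; apply: rpredM.
  by apply: rpredM; last exact: rpredM; rewrite !rpredM ?rpredX.
have clV : {in Qclosure, forall x, x^-1 \in Qclosure}.
  move=> x /asboolP hx; have [->|x0] := eqVneq x 0.
    by rewrite invr0; apply: sub_Qclosure; rewrite rpred0.
  apply/asboolP => n; have [c Rc] := mul_tX_mem x^-1.
  have [q Qq Rq] := hx (n + c + c).+1; exists q^-1; first by rewrite rpredV.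
  pose s := - ((x - q) / t ^+ (n + c + c).+1 * (t ^+ (n + c) * (x^-1 * t ^+ c))).
  have Rs : s \in R by rewrite rpredN rpredM // rpredM ?rpredX.
  have qE : q = x * (1 + t * s).
    by rewrite /s exprS !exprD; field; rewrite x0 t0 !tX0.
  have s0 : 1 + t * s != 0.
    have Vs : t * s / t \in V by rewrite mulrAC divff // mul1r RV.
    by have /and3P[] := imm_unitD imm (imm_unit1 V) Vs.
  have -> : (x^-1 - q^-1) / t ^+ n
    = - ((x - q) / t ^+ (n + c + c).+1) * t * (x^-1 * t ^+ c) * (x^-1 * t ^+ c)
       * (1 + t * s)^-1.
    have -> : q^-1 = x^-1 * (1 + t * s)^-1 by rewrite qE invfM.
    have -> : x - q = - x * (t * s) by rewrite qE; ring.
    by rewrite exprS !exprD; field; rewrite s0 x0 t0 !tX0.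
  apply: rpredM; last exact: inv_1Dt_mem.
  by apply: rpredM => //; apply: rpredM => //; apply: rpredM => //; rewrite rpredN.
split=> //; first by apply: sub_Qclosure; rewrite rpred1.
by move=> x y hx hy; apply: clM => //; apply: clV.
Qed.

HB.instance Definition _ :=
  GRing.isDivringClosed.Build F Qclosure Qclosure_divring.

Lemma Qclosure_full : {subset predT <= Qclosure} -> {subset V <= R}.
Proof.
move=> full x Vx; have /asboolP/(_ 1%N)[q Qq] := full x isT; rewrite expr1 => Rq.
have Rxq : x - q \in R by rewrite -(mulfVK t0 (x - q)) rpredM.
rewrite -(subrK q x) rpredD // UR //; apply: (imm_int imm) => //.
by rewrite -(subKr x q) rpredB // RV.
Qed.

(** This is [pow_div_mem] for [x - q] with [x] in [F], after scaling [x] into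
    [R]. *)
Lemma pow_near x j N : (l <= j)%N ->
  exists n, forall q, q \in Q -> (x - q) / t ^+ n \in V -> (x - q) ^+ j / t ^+ N \in R.
Proof.
move=> lj; have [c Rc] := mul_tX_mem x; exists (N + c * j)%N => q Qq Vq.
pose z := (x - q) * t ^+ c.
have Vz : z / t ^+ (N + c * j + c) \in V.
  by rewrite exprD invfM /z [_^-1 * _^-1]mulrC mulrA mulfK.
have Rz : z \in R.
  rewrite /z mulrBl rpredB // UR //; apply: (imm_int imm).
    by rewrite rpredM // (imm_tX_frac imm).
  have -> : q * t ^+ c = x * t ^+ c - z by rewrite /z; ring.
  by rewrite rpredB ?(imm_div_mem imm Vz) ?RV.
have := nilR lj Rz Vz; have -> : z ^+ j / t ^+ (N + c * j + c)
    = (x - q) ^+ j / t ^+ N / t ^+ c.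
  by rewrite /z exprMn -exprM !exprD; field; rewrite !tX0.
by move=> h; rewrite -(mulfVK (tX0 c) (_ / t ^+ N)) rpredM ?rpredX.
Qed.

(** Let [K e] be the subfield of the [x] such that [x ^+ (p ^ e)] is in the
    closure of [Q].  As [x ^+ (p ^ e) - q ^+ (p ^ e)] is a power of [x - q],
    [pow_near] shows that [K e] is [F] for [e] large.  If [K e.+1] is [F] then
    [K e] contains the [p]-th powers, and it contains [Q], so it is [F]. *)
Lemma Qclosure_pchar p : p \in [pchar F] ->
  generated_subfield [predU Q & pth_powers p] =i predT -> {subset predT <= Qclosure}.
Proof.
move=> pF gen.
have pe e : [pchar F].-nat (p ^ e)%N.
  by rewrite (eq_pnat _ (pcharf_eq pF)) pnatX pnat_id ?orbT // (pcharf_prime pF).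
pose K e : {pred F} := fun x => x ^+ (p ^ e) \in Qclosure.
have KE e x : (x \in K e) = (x ^+ (p ^ e) \in Qclosure) by [].
have Kdiv e : divring_closed (K e).
  split.
  - by rewrite KE expr1n rpred1.
  - by move=> x y; rewrite !KE => Kx Ky; rewrite exprDn_pchar // exprNn_pchar // rpredB.
  - by move=> x y; rewrite !KE => Kx Ky; rewrite expr_div_n rpred_div.
suff H e x : x \in K e by move=> x _; have := H 0%N x; rewrite KE expn0 expr1.
suff [d hd] : exists d, forall x, x \in K (e + d)%N.
  elim: d hd x => [|d IH] hd; first by move=> x; rewrite -[e]addn0; apply: hd.
  apply: IH => x.
  pose Kd : divringClosed F :=
    HB.pack (K (e + d)%N) (GRing.isDivringClosed.Build F (K (e + d)%N) (Kdiv _)).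
  have /asboolP/(_ Kd) : x \in generated_subfield [predU Q & pth_powers p] by rewrite gen.
  apply=> y /orP[Qy|/asboolP[w ->]].
    by rewrite KE rpredX // sub_Qclosure.
  by have := hd w; rewrite addnS KE expnS exprM.
exists l => {}x; rewrite KE; apply/asboolP => N.
have le : (l <= p ^ (e + l))%N.
  rewrite (leq_trans (ltnW (ltn_expl l (prime_gt1 (pcharf_prime pF))))) //.
  by rewrite leq_exp2l ?leq_addl // prime_gt1 // (pcharf_prime pF).
have [n hn] := pow_near x N le; have [q Qq Vq] := imm_approx_frac imm n x.
exists (q ^+ (p ^ (e + l))); first by rewrite rpredX.
by rewrite -exprNn_pchar // -exprDn_pchar // hn.
Qed.

Lemma algebraic_integral_poly x : algebraicOver (val : quotient_field_type U -> F) x ->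
  exists2 f : {poly F}, f \is a polyOver U & f != 0 /\ root f x.
Proof.
case=> p p0 px; pose f := map_poly (val : quotient_field_type U -> F) p.
have fQ i : f`_i \in Q by rewrite coef_map_id0 ?rmorph0 //; apply: valP.
have f0 : f != 0 by rewrite map_poly_eq0_id0 ?fmorph_eq0 // lead_coef_eq0.
have [c hc] : exists c, forall i, (i < size f)%N -> f`_i * t ^+ c \in V.
  elim: (size f) => [|n [c hc]]; first by exists 0%N.
  have [d hd] := imm_frac imm f`_n; exists (c + d)%N => i.
  have Vt k : t ^+ k \in V by rewrite rpredX ?(imm_sub imm).
  rewrite ltnS leq_eqVlt exprD => /orP[/eqP->|/hc hi].
    by rewrite mulrCA rpredM.
  by rewrite mulrA rpredM.
exists (t ^+ c *: f); last first.
  by rewrite scaler_eq0 negb_or tX0 f0 rootE hornerZ (rootP px) mulr0.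
apply/polyOverP => i; rewrite coefZ mulrC; apply: (imm_int imm).
  by rewrite rpredM // (imm_tX_frac imm).
have [|le] := ltnP i (size f); first exact: hc.
by rewrite nth_default // mul0r rpred0.
Qed.

(** In characteristic 0, a polynomial of minimal degree vanishing at [x] has a
    nonzero derivative, of smaller degree. *)
Lemma separable_poly_at x : [pchar F] =i pred0 ->
  algebraicOver (val : quotient_field_type U -> F) x ->
  exists f : {poly F}, [/\ f \is a polyOver U, root f x & f^`().[x] != 0].
Proof.
move=> ch0 /algebraic_integral_poly[f0 Uf0 [f0n0 f0x]].
pose P n := `[< exists f : {poly F},
  [/\ f \is a polyOver U, f != 0, root f x & size f = n] >].
have exP : exists n, P n by exists (size f0); apply/asboolP; exists f0.
case: (ex_minnP exP) => n /asboolP[f [Uf f0' fx sf]] minn.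
exists f; split=> //; apply/negP => /eqP f'x.
have Uf' : f^`() \is a polyOver U by apply: polyOver_deriv.
have [f'0|f'0] := eqVneq f^`() 0; last first.
  have /minn : P (size f^`()) by apply/asboolP; exists f^`(); split=> //; apply/rootP.
  by rewrite leqNgt -sf lt_size_deriv.
have s1 : (1 < size f)%N by apply: root_size_gt1 fx.
have /polyP/(_ (size f).-2) := f'0; rewrite coef_deriv coef0 prednK -?subn1 ?subn_gt0 //.
rewrite subn1 -lead_coefE => /eqP; rewrite -mulr_natr mulf_eq0 lead_coef_eq0 (negbTE f0') /=.
have /pcharf0P-> := ch0; by rewrite -subn1 subn_eq0 leqNgt s1.
Qed.

(** Let [x] be a simple root of [f] over [U], let [q] in [Q] tend to [x] in [V],
    and let [z := x - q].  Taylor's formula is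
    [0 = f.[q] + f^`().[q] * z + z ^+ 2 * h].  Here [f.[q]] is in [U] and tends to
    0 in [V], hence in [R], while [f^`().[q]] is in [U] with a value that is
    eventually that of [f^`().[x]].  Multiplying by [z ^+ j], if [z ^+ j.+2]
    tends to 0 in [R] then so does [z ^+ j.+1]; start from [pow_near] and
    descend to [z]. *)
Lemma Qclosure_pchar0 : [pchar F] =i pred0 ->
  algebraic_over_quotient_field U -> {subset predT <= Qclosure}.
Proof.
move=> ch0 alg.
suff H x : x \in R -> x \in Qclosure.
  move=> x _; have [c Rc] := mul_tX_mem x; rewrite -(mulfK (tX0 c) x) rpred_div ?H //.
  by rewrite rpredX.
move=> Rx; have [f [Uf fx f'x]] := separable_poly_at ch0 (alg x).
have Rf : f \is a polyOver R.
  by apply/polyOverP => i; apply/UR/(polyOverP Uf).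
have Uf' : f^`() \is a polyOver U by apply: polyOver_deriv.
have Rf' : f^`() \is a polyOver R by apply: polyOver_deriv.
have [d ud] : exists d, f^`().[x] / t ^+ d \in units_of V.
  by apply: (imm_ord imm) => //; apply/RV/rpred_horner.
pose Z j := forall N, exists n, forall q, q \in Q -> (x - q) / t ^+ n \in V ->
  (x - q) ^+ j / t ^+ N \in R.
suff Z1 : Z 1%N.
  apply/asboolP => N; have [n hn] := Z1 N; have [q Qq Vq] := imm_approx_frac imm n x.
  by exists q; rewrite // -[x - q]expr1 hn.
have Zl : Z l.+1 by move=> N; apply: pow_near.
elim: (l) Zl => // j IH Z2; apply: IH => N.
have [n0 hn0] := Z2 (N + d)%N; exists (maxn n0 (N + d).+1) => q Qq Vq.
have {hn0} z2 : (x - q) ^+ j.+2 / t ^+ (N + d) \in R.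
  by apply: hn0 => //; apply: (imm_div_le imm _ Vq); rewrite ?leq_maxl.
have {Vq} Vz : (x - q) / t ^+ (N + d).+1 \in V.
  by apply: (imm_div_le imm _ Vq); rewrite ?leq_maxr.
have Uq : q \in U.
  apply: (imm_int imm) => //; rewrite -(subKr x q); apply: rpredB; first exact: RV.
  exact: (imm_div_mem imm Vz).
set z := x - q in z2 Vz *.
have Rz : z \in R by apply: rpredB => //; apply: UR.
have xE : x = q + z by rewrite /z addrC subrK.
have Rq := UR Uq.
have [h Rh hE] := horner_taylor2 Rf Rq Rz.
have [k Rk kE] := horner_taylor2 Rf' Rq Rz.
rewrite -xE (rootP fx) in hE; rewrite -xE in kE.
set e := f^`().[q] in hE kE.
have Ue : e \in U by apply: rpred_horner.
have ue : e / t ^+ d \in units_of V.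
  have -> : e / t ^+ d = f^`().[x] / t ^+ d + - (z * (f^`()^`().[q] + z * k) / t ^+ d).
    by rewrite kE -mulrBl; congr (_ / _); ring.
  apply: (imm_unitD imm) => //; rewrite mulNr rpredN -[_ / t]mulrA -invfM -exprSr mulrAC.
  apply: rpredM; first by apply: (imm_div_le imm _ Vz); rewrite // ltnS leq_addl.
  apply: RV; rewrite rpredD ?rpredM //.
  by apply: rpred_horner => //; apply: polyOver_deriv.
have Re : (e / t ^+ d)^-1 \in R.
  apply: integral_inv_mem => //; apply/UR/(imm_U_div imm) => //.
  by case/and3P: ue.
have Rfq : f.[q] / t ^+ (N + d) \in R.
  apply/UR/(imm_U_div imm); first exact: rpred_horner.
  have -> : f.[q] = - (z * (e + z * h)).
    by apply/eqP; rewrite -subr_eq0 opprK; apply/eqP; rewrite [RHS]hE; ring.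
  rewrite mulNr rpredN mulrAC rpredM //; first by apply: (imm_div_le imm _ Vz).
  by apply: RV; rewrite rpredD ?rpredM // UR.
have e0 : e != 0 by case/and3P: ue => + _ _; rewrite mulf_eq0 negb_or => /andP[].
have -> : z ^+ j.+1 / t ^+ N = - (e / t ^+ d)^-1 *
   (f.[q] / t ^+ (N + d) * z ^+ j + z ^+ j.+2 / t ^+ (N + d) * h).
  have -> : f.[q] = - (z * (e + z * h)).
    by apply/eqP; rewrite -subr_eq0 opprK; apply/eqP; rewrite [RHS]hE; ring.
  by rewrite !exprS !exprD; field; rewrite e0 !tX0.
rewrite rpredM ?rpredN // rpredD // rpredM //; exact: rpredX.
Qed.

End Closure.

End Intermediate.

(** * Nilpotents in completions *)

Section Completion.
Local Open Scope quotient_scope.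
Variables (A : comNzRingType) (M : idealr A).

Lemma cauchy_valX (a : cauchy_seq M) n k : val (a ^+ n) k = val a k ^+ n.
Proof.
elim: n => [|n IH]; first by rewrite !expr0 rmorph1.
by rewrite !exprS rmorphM /= -IH.
Qed.

Local Notation pi := \pi_{ideal_quot @adic_null A M}.

Lemma adic_null_pi (a : cauchy_seq M) :
  (a \in @adic_null A M) = (pi a == 0 :> completion M).
Proof. by rewrite -[a in LHS]subr0 Quotient.idealrBE -[RHS]/(_ == _) -(rmorph0 pi). Qed.

Lemma completion_nilpotentP :
  (exists2 x : completion M, x != 0 & exists n : nat, x ^+ n = 0) <->
  (exists2 a : cauchy_seq M, a \notin @adic_null A M &
     exists n, a ^+ n \in @adic_null A M).
Proof.
have piX (a : cauchy_seq M) n : pi (a ^+ n) = (pi a : completion M) ^+ n.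
  exact: (rmorphXn pi).
split=> [[x x0 [n xn]]|[a a0 [n an]]].
  exists (repr (x : {ideal_quot @adic_null A M})); first by rewrite adic_null_pi reprK.
  by exists n; rewrite adic_null_pi piX reprK xn.
exists (pi a : completion M); first by rewrite -adic_null_pi.
by exists n; rewrite -piX; apply/eqP; rewrite -adic_null_pi.
Qed.

End Completion.

Section Local.
Variables (F : fieldType) (U V R : subringClosed F) (t : F).
Hypothesis imm : immediate_at U V t.
Hypothesis UR : {subset U <= R}.
Hypothesis RV : {subset R <= V}.
Variable M : idealr (subring_type R).
Hypothesis MV : forall x, (x \in M) = (val x / t \in V).

Let t0 : t != 0 := imm_t0 imm.

Lemma ideal_span_span (s : seq (subring_type R)) x :
  x \in ideal_span (mem s) -> span_over R [seq val y | y <- s] (val x).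
Proof.
move=> /asboolP[c cs ->]; rewrite big_seq; elim/big_ind: _ => [||c' /cs h].
- by rewrite rmorph0; apply: span0.
- by move=> y z hy hz; rewrite rmorphD; apply: spanD.
- by rewrite rmorphM; apply: spanZ; [apply: valP | apply/span_mem/map_f].
Qed.

Lemma ideal_pow_sub k x : x \in ideal_pow M k -> val x / t ^+ k \in V.
Proof.
elim: k x => [|k IH] x; first by move=> _; rewrite expr0 divr1; apply/RV/valP.
move=> /asboolP[c cs ->]; rewrite rmorph_sum mulr_suml big_seq.
apply: rpred_sum => d /cs /asboolP[a [b [Ma /IH Vb dE]]].
rewrite rmorphM dE rmorphM exprS invfM /=.
have -> : val d.1 * (val a * val b) * (t^-1 / t ^+ k)
    = val d.1 * ((val a / t) * (val b / t ^+ k)) by ring.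
by apply: rpredM; [apply/RV/valP | apply: rpredM => //; rewrite -MV].
Qed.

(** The converse of [ideal_pow_sub] when [R] is [V]; in general only divisibility
    in [R] itself is sufficient. *)
Lemma ideal_pow_mem k x : val x / t ^+ k \in R -> x \in ideal_pow M k.
Proof.
elim: k x => [//|k IH] x Rx.
pose y : subring_type R := SubringType Rx.
pose t' : subring_type R := SubringType (UR (imm_t imm)).
have Mt : t' \in M by rewrite MV /= divff // rpred1.
have E : x = t' * (t' ^+ k * y).
  by apply: val_inj; rewrite rmorphM rmorphM rmorphXn /= mulrA -exprS mulrC divfK ?expf_neq0.
apply/asboolP; exists [:: (1, x)]; last by rewrite big_seq1 mul1r.
move=> _ /[1!inE] /eqP-> /=; apply/asboolP; exists t', (t' ^+ k * y); split=> //.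
apply: IH; rewrite rmorphM rmorphXn /= mulrC mulKf ?expf_neq0 //; exact: valP.
Qed.

(** When [R] is [V], the power [M ^+ k] is [t ^+ k * V], and an element of [V]
    whose [e]-th power is in [t ^+ (e * k) * V] is in [t ^+ k * V]. *)
Lemma dvr_not_ramified : {subset V <= R} ->
  ~ exists2 x : completion M, x != 0 & exists n : nat, x ^+ n = 0.
Proof.
move=> VR /completion_nilpotentP[a /negP a0 [e /asboolP ae]]; apply: a0.
apply/asboolP => k; case: e ae => [|e] ae.
  have [n /(_ n (leqnn n)) /ideal_pow_sub] := ae 1%N.
  rewrite cauchy_valX expr0 rmorph1 => h.
  by have := imm_unitN imm (imm_unit1 V); rewrite -[t]expr1 h.
have [n hn] := ae (e.+1 * k)%N; exists n => m /hn /ideal_pow_sub.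
rewrite cauchy_valX rmorphXn mulnC exprM -expr_div_n => Vz.
apply/ideal_pow_mem/VR; set z := _ / _ in Vz *.
have [->|z0] := eqVneq z 0; first exact: rpred0.
have [//|Vz'] := imm_val imm z.
have -> : z = z ^+ e.+1 * z^-1 ^+ e by rewrite exprVn exprS mulfK ?expf_neq0.
by apply: rpredM => //; apply: rpredX.
Qed.

End Local.

(** The generators of the maximal ideal, provided by noetherianity, make [R]
    finite modulo [t], so that the closure of [Q] can be computed; it cannot be
    [F], because [R] would then be [V]. *)
Lemma ramified_transcendental_or_inseparable (F : fieldType) (U V R : subringClosed F) t :
  immediate_at U V t -> quotient_field V =i predT -> {subset U <= R} ->
  noetherian (subring_type R) -> normalization R =i V ->
  analytically_ramified (subring_type R) ->
  ([pchar F] =i pred0 /\ ~ algebraic_over_quotient_field U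
   \/
   exists2 p : nat, p \in [pchar F] &
     ~ (generated_subfield [predU quotient_field U & pth_powers p]
          =i predT)).
Proof.
move=> imm fracV UR noethR normR [M Mnu ram].
have t0 := imm_t0 imm.
have fracR x : x \in quotient_field R.
  have /asboolP[a [b [Va Vb b0 ->]]] : x \in quotient_field V by rewrite fracV.
  move: Va Vb; rewrite -!normR => /asboolP[Qa _] /asboolP[Qb _].
  by rewrite rpred_div.
have intR : {in V, forall x, exists n, integral_deg R n x}.
  by move=> x; rewrite -normR => /asboolP[_ /integralOver_deg].
have RV : {subset R <= V}.
  move=> x Rx; rewrite -normR; apply/asboolP; split=> //.
  exact: (integral_id (val : subring_type R -> F) (SubringType Rx)).
have MV x : (x \in M) = (val x / t \in V).
  rewrite Mnu inE /= -[x \is a GRing.unit]/(val x \in units_of R).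
  apply/idP/idP => [nux|Vx].
    have [ux|//] := imm_unit_or imm (RV _ (valP x)).
    case/negP: nux; have /and3P[x0 _ _] := ux; apply/and3P; split=> //; first exact: valP.
    by apply: (integral_inv_mem intR) => //; apply: valP.
  apply: contraL Vx => /and3P[x0 Rx Rx']; apply: (imm_unitN imm).
  by apply/and3P; split=> //; apply: RV.
have [G hG] := noethR M.
have [|x Rx Vx|S SR Sgen] := finite_mod_t imm UR RV intR (G := [seq val y | y <- G]).
- move=> _ /mapP[g gG ->]; split; first exact: valP.
  rewrite -MV hG; apply/asboolP; exists [:: (1, g)]; last by rewrite big_seq1 mul1r.
  by move=> _ /[1!inE] /eqP->.
- by apply: (@ideal_span_span _ _ _ (SubringType Rx)); rewrite -hG MV.
have nilR y n j := @pow_div_mem _ _ _ _ _ imm UR RV intR fracR S SR Sgen y n j.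
have contra : {subset predT <= Qclosure U R t} -> False.
  move=> /(Qclosure_full imm UR RV) VR.
  exact: (dvr_not_ramified imm UR RV MV VR ram).
have [[p pF]|nop] := pselect (exists p, p \in [pchar F]).
  right; exists p => // gen; apply: contra.
  exact: (Qclosure_pchar imm UR RV intR fracR nilR pF gen).
have ch0 : [pchar F] =i pred0.
  by move=> p; rewrite inE; apply/negP => pF; apply: nop; exists p.
left; split=> // alg; apply: contra.
exact: (Qclosure_pchar0 imm UR RV intR fracR nilR ch0 alg).
Qed.

(** * Dual numbers and the existence of derivations *)

(** [Dual a b] is [a + b * eps] with [eps ^+ 2 = 0]. *)
Record dual (F : fieldType) : Type := Dual { re : F; eps : F }.

Section Dual.
Variable F : fieldType.
Implicit Types x y : dual F.

Let pair_of x := (re x, eps x).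
Let of_pair (p : F * F) := Dual p.1 p.2.
Let pair_ofK : cancel pair_of of_pair. Proof. by case. Qed.
HB.instance Definition _ := Choice.copy (dual F) (can_type pair_ofK).

Lemma dual_eq x y : re x = re y -> eps x = eps y -> x = y.
Proof. by case: x y => [? ?] [? ?] /= -> ->. Qed.

Let dual0 : dual F := Dual 0 0.
Let dualN x := Dual (- re x) (- eps x).
Let dualD x y := Dual (re x + re y) (eps x + eps y).
Let dual1 : dual F := Dual 1 0.
Let dualM x y := Dual (re x * re y) (re x * eps y + eps x * re y).

Fact dual_addA : associative dualD.
Proof. by move=> x y z; apply: dual_eq => /=; ring. Qed.
Fact dual_addC : commutative dualD.
Proof. by move=> x y; apply: dual_eq => /=; ring. Qed.
Fact dual_add0 : left_id dual0 dualD.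
Proof. by move=> x; apply: dual_eq => /=; ring. Qed.
Fact dual_addN : left_inverse dual0 dualN dualD.
Proof. by move=> x; apply: dual_eq => /=; ring. Qed.
HB.instance Definition _ := GRing.isZmodule.Build (dual F)
  dual_addA dual_addC dual_add0 dual_addN.

Fact dual_mulA : associative dualM.
Proof. by move=> x y z; apply: dual_eq => /=; ring. Qed.
Fact dual_mulC : commutative dualM.
Proof. by move=> x y; apply: dual_eq => /=; ring. Qed.
Fact dual_mul1 : left_id dual1 dualM.
Proof. by move=> x; apply: dual_eq => /=; ring. Qed.
Fact dual_mulDl : left_distributive dualM +%R.
Proof. by move=> x y z; apply: dual_eq => /=; ring. Qed.
Fact dual_one_neq0 : dual1 != 0.
Proof. by apply/eqP => /(congr1 (@re F)) /eqP; rewrite /= oner_eq0. Qed.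
HB.instance Definition _ := GRing.Zmodule_isComNzRing.Build (dual F)
  dual_mulA dual_mulC dual_mul1 dual_mulDl dual_one_neq0.

Fact re_zmod_morphism : zmod_morphism (@re F). Proof. by []. Qed.
Fact re_monoid_morphism : monoid_morphism (@re F). Proof. by []. Qed.
HB.instance Definition _ :=
  GRing.isZmodMorphism.Build (dual F) F (@re F) re_zmod_morphism.
HB.instance Definition _ :=
  GRing.isMonoidMorphism.Build (dual F) F (@re F) re_monoid_morphism.

Lemma epsD x y : eps (x + y) = eps x + eps y. Proof. by []. Qed.
Lemma epsB x y : eps (x - y) = eps x - eps y. Proof. by []. Qed.
Lemma epsM x y : eps (x * y) = re x * eps y + eps x * re y. Proof. by []. Qed.

Lemma dual_exp (w c : F) n : Dual w c ^+ n = Dual (w ^+ n) (c * w ^+ n.-1 *+ n).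
Proof.
elim: n => [|n IH]; first by rewrite !expr0 mulr0n.
rewrite exprS IH; apply: dual_eq; rewrite ?epsM /=; first by rewrite exprS.
case: n {IH} => [|n]; first by rewrite mulr0n mulr0 add0r mulr1n.
by rewrite mulrnAr mulrCA -exprS -mulrSr.
Qed.

Lemma dual_mul_eq0 x y : re x != 0 -> x * y = 0 -> y = 0.
Proof.
move=> x0 /[dup] /(congr1 (@re F)) /eqP + /(congr1 (@eps F)) /eqP.
rewrite epsM rmorphM mulf_eq0 (negbTE x0) /= => /eqP y0.
rewrite y0 mulr0 addr0 mulf_eq0 (negbTE x0) /= => /eqP ey.
exact: dual_eq.
Qed.

(** The infinitesimal part of the argument contributes through the derivative
    only; this is how the value of a derivation at a new element is solved
    for. *)
Lemma dual_horner (p : {poly dual F}) (w c : F) :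
  p.[Dual w c] = p.[Dual w 0] + Dual 0 (c * (map_poly (@re F) p)^`().[w]).
Proof.
elim/poly_ind: p => [|p a IH].
  by rewrite rmorph0 deriv0 !horner0 mulr0 add0r.
rewrite !hornerMXaddC IH rmorphD rmorphM /= map_polyX map_polyC derivMXaddC.
rewrite hornerD hornerM hornerX.
have -> : (map_poly (@re F) p).[w] = re p.[Dual w 0] by rewrite -horner_map.
by apply: dual_eq; rewrite ?(epsD, epsM, rmorphD, rmorphM) /=; ring.
Qed.

End Dual.

(** Stated over an arbitrary commutative ring because it is applied both to
    subfields and to rings of dual numbers, where leading coefficients have no
    inverse at hand. *)
Lemma pseudo_division (A : comNzRingType) (G : subringClosed A) (f p : {poly A}) :
  f \is a polyOver G -> p \is a polyOver G -> f != 0 ->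
  exists k q r, [/\ q \is a polyOver G, r \is a polyOver G,
    (size r < size f)%N & lead_coef f ^+ k *: p = q * f + r].
Proof.
move=> Gf Gp f0; have [n] := ubnP (size p); elim: n p Gp => // n IH p Gp sp.
have [lt|le] := ltnP (size p) (size f).
  by exists 0%N, 0, p; split; rewrite ?rpred0 // scale1r mul0r add0r.
have sf : (0 < size f)%N by rewrite size_poly_gt0.
pose q0 := lead_coef p *: 'X^(size p - size f).
have Gq0 : q0 \is a polyOver G.
  by apply: polyOverZ; [apply: (polyOverP Gp) | rewrite rpredX ?polyOverX].
pose p' := lead_coef f *: p - q0 * f.
have Gp' : p' \is a polyOver G.
  by apply: rpredB; [apply: polyOverZ; [apply: (polyOverP Gf)|] | apply: rpredM].
have sp' : (size p' < size p)%N.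
  rewrite -(prednK (leq_trans sf le)) ltnS; apply/leq_sizeP => j hj.
  rewrite coefB coefZ /q0 -scalerAl coefZ coefXnM.
  have -> : (j < size p - size f)%N = false by lia.
  have [->|ne] := eqVneq j (size p).-1.
    rewrite (_ : _ - _ = (size f).-1)%N; last by lia.
    by rewrite !lead_coefE mulrC subrr.
  have spj : (size p <= j)%N by move/eqP: ne => ne; lia.
  have sfj : (size f <= j - (size p - size f))%N by lia.
  by rewrite [p`_j]nth_default // [f`__]nth_default // !mulr0 subrr.
have [|k [q [r [Gq Gr sr E]]]] := IH p' Gp'; first exact: leq_trans sp' sp.
exists k.+1, (lead_coef f ^+ k *: q0 + q), r; split=> //.
  by rewrite rpredD // polyOverZ // rpredX //; apply: (polyOverP Gf).
have -> : lead_coef f ^+ k.+1 *: p = lead_coef f ^+ k *: (q0 * f) + lead_coef f ^+ k *: p'.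
  by rewrite -scalerDr /p' addrC subrK scalerA -exprSr.
by rewrite E mulrDl scalerAl addrA.
Qed.

Lemma divring_pseudo_min (F : fieldType) (L : divringClosed F) (z : F) (f : {poly F}) :
  f \is a polyOver L -> f != 0 -> f.[z] = 0 ->
  (forall g : {poly F}, g \is a polyOver L -> g.[z] = 0 -> (size g < size f)%N -> g = 0) ->
  forall g : {poly F}, g \is a polyOver L -> g.[z] = 0 -> f %| g.
Proof.
move=> Lf f0 fz fmin g Lg gz.
have [k [q [r [Lq Lr sr E]]]] := pseudo_division Lf Lg f0.
have r0 : r = 0.
  apply: fmin => //; move/(congr1 (horner^~ z)): E.
  by rewrite hornerZ gz mulr0 hornerD hornerM fz mulr0 add0r.
have a0 : lead_coef f ^+ k != 0 by rewrite expf_neq0 // lead_coef_eq0.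
by rewrite -(dvdpZr _ _ a0) E r0 addr0 dvdp_mulIr.
Qed.

(** A polynomial [f] of minimal degree divides [('X - z) ^+ p], so it is a scalar
    multiple of a power of ['X - z].  If [f^`()] vanishes at [z] then it is 0 and
    [p] divides the degree of [f]; otherwise [f] is linear and [z] is in [L]. *)
Lemma purely_inseparable_size (F : fieldType) (L : divringClosed F) (z : F) p :
  p \in [pchar F] -> z ^+ p \in L -> z \notin L ->
  forall f : {poly F}, f \is a polyOver L -> f != 0 -> f.[z] = 0 -> (p < size f)%N.
Proof.
move=> pF Lzp Lz f1 Lf1 f10 f1z.
pose P n := `[< exists f : {poly F},
  [/\ f \is a polyOver L, f != 0, f.[z] = 0 & size f = n] >].
have exP : exists n, P n by exists (size f1); apply/asboolP; exists f1.
case: (ex_minnP exP) => n /asboolP[f [Lf f0 fz sf]] minn.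
have fmin g : g \is a polyOver L -> g.[z] = 0 -> (size g < size f)%N -> g = 0.
  move=> Lg gz lt; apply/eqP/negPn/negP => g0.
  have /minn : P (size g) by apply/asboolP; exists g.
  by rewrite -sf leqNgt lt.
have {minn} : (size f <= size f1)%N by rewrite sf minn //; apply/asboolP; exists f1.
apply: leq_trans.
have s1 : (1 < size f)%N by apply: (root_size_gt1 (a := z) f0); apply/rootP.
have [f'z|f'z] := eqVneq f^`().[z] 0.
  have f'0 : f^`() = 0 by apply: fmin; rewrite ?polyOver_deriv // lt_size_deriv.
  have /polyP/(_ (size f).-2) := f'0; rewrite coef_deriv coef0 prednK; last by lia.
  rewrite -lead_coefE => /eqP; rewrite -mulr_natr mulf_eq0 lead_coef_eq0 (negbTE f0) /=.
  rewrite -(dvdn_pcharf pF) => /(dvdn_leq _) le.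
  have {}le : (p <= (size f).-1)%N by apply: le; rewrite -subn1 subn_gt0.
  by apply: (leq_ltn_trans le); rewrite ltn_predL (ltnW s1).
have : f %| ('X - z%:P) ^+ p.
  have pP : p \in [pchar {poly F}] by rewrite pchar_poly.
  have pn : [pchar {poly F}].-nat p.
    by rewrite (eq_pnat _ (pcharf_eq pP)) pnat_id // (pcharf_prime pF).
  rewrite exprDn_pchar // exprNn_pchar // -rmorphXn /=.
  apply: (divring_pseudo_min Lf f0 fz fmin).
    by rewrite rpredB ?rpredX ?polyOverX // polyOverC.
  by rewrite !hornerE subrr.
move=> /dvdp_exp_XsubCP[k _ /eqpP[[c1 c2] /andP[/= c10 c20] /= E]].
have fE : f = (c2 / c1) *: ('X - z%:P) ^+ k.
  by rewrite -[c2 / c1]mulrC -scalerA -E scalerA mulVf // scale1r.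
have sk : size f = k.+1.
  by rewrite fE size_scale ?mulf_neq0 ?invr_eq0 // size_exp_XsubC.
have k1 : k = 1%N.
  case: k {E} fE sk => [|[|k]] // fE sk; first by rewrite sk in s1.
  case/eqP: f'z; rewrite fE derivZ hornerZ deriv_exp derivXsubC mul1r hornerMn.
  by rewrite horner_exp hornerXsubC subrr exprS mul0r mul0rn mulr0.
case/negP: Lz; have Lc i : f`_i \in L by apply/polyOverP.
have -> : z = - (f`_0 / f`_1).
  rewrite fE k1 expr1 !coefZ !coefB !coefX !coefC /= subr0 mulr1 sub0r.
  by field; rewrite c10 c20.
by rewrite rpredN rpred_div.
Qed.

Section Graph.
Variables (F : fieldType) (L : divringClosed F).
Local Open Scope classical_set_scope.

(** The graph of a derivation into [F], trivial on [L], of a subring of [F]: the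
    dual number [Dual x d] is in the graph when [d] is the derivative of [x].
    Being a subring encodes additivity and the Leibniz rule, and the last clause
    makes the derivative a function of [x]. *)
Record derivation_graph (G : set (dual F)) : Prop := Graph {
  graph_base : forall q, q \in L -> G (Dual q 0);
  graphB : forall x y, G x -> G y -> G (x - y);
  graphM : forall x y, G x -> G y -> G (x * y);
  graph_fun : forall x, G x -> re x = 0 -> x = 0 }.

Lemma graph_subring G : derivation_graph G -> subring_closed (fun x => `[< G x >]).
Proof.
move=> gG; split.
- by apply/asboolP/(graph_base gG)/rpred1.
- by move=> x y /asboolP hx /asboolP hy; apply/asboolP; exact: (graphB gG hx hy).
- by move=> x y /asboolP hx /asboolP hy; apply/asboolP; exact: (graphM gG hx hy).
Qed.

Definition graph_ring G (gG : derivation_graph G) : subringClosed (dual F) :=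
  HB.pack (fun x => `[< G x >])
    (GRing.isSubringClosed.Build (dual F) _ (graph_subring gG)).

Lemma graph_ringP G (gG : derivation_graph G) x : reflect (G x) (x \in graph_ring gG).
Proof. exact: asboolP. Qed.

Definition adjoin G (gG : derivation_graph G) (w : dual F) : set (dual F) :=
  fun x => exists2 p, p \is a polyOver (graph_ring gG) & x = p.[w].

Lemma adjoin_graph G (gG : derivation_graph G) w :
  (forall p, p \is a polyOver (graph_ring gG) -> re p.[w] = 0 -> p.[w] = 0) ->
  [/\ derivation_graph (adjoin gG w), G `<=` adjoin gG w & adjoin gG w w].
Proof.
move=> h.
have sub : G `<=` adjoin gG w.
  by move=> x Gx; exists x%:P; rewrite ?hornerC // polyOverC; apply/graph_ringP.
split=> //; last by exists 'X; rewrite ?hornerX ?polyOverX.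
split.
- by move=> q Lq; apply/sub/(graph_base gG).
- move=> _ _ [p Gp ->] [q Gq ->]; exists (p - q); first exact: rpredB.
  by rewrite hornerD hornerN.
- move=> _ _ [p Gp ->] [q Gq ->]; exists (p * q); first exact: rpredM.
  by rewrite hornerM.
- by move=> _ [p Gp ->]; apply: h.
Qed.

(** Pseudo-divide a polynomial [p] with [re p.[w] = 0] by [f]: the remainder is 0
    by minimality, so a power of the leading coefficient of [f] kills [p.[w]];
    and the leading coefficient is not infinitesimal. *)
Lemma minimal_relation G (gG : derivation_graph G) w f :
  f \is a polyOver (graph_ring gG) -> f != 0 -> f.[w] = 0 ->
  (forall g, g \is a polyOver (graph_ring gG) -> re g.[w] = 0 ->
     (size g < size f)%N -> g = 0) ->
  forall p, p \is a polyOver (graph_ring gG) -> re p.[w] = 0 -> p.[w] = 0.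
Proof.
move=> Gf f0 fw fmin p Gp pw.
have [k [q [r [Gq Gr sr E]]]] := pseudo_division Gf Gp f0.
move/(congr1 (horner^~ w)): E; rewrite hornerZ hornerD hornerM fw mulr0 add0r => E.
have r0 : r = 0 by apply: fmin; rewrite // -E rmorphM /= pw mulr0.
move: E; rewrite r0 horner0; apply: dual_mul_eq0.
rewrite rmorphXn expf_neq0 //; apply/eqP => a0.
have : lead_coef f = 0.
  by apply: (graph_fun gG) => //; apply/graph_ringP/(polyOverP Gf).
by apply/eqP; rewrite lead_coef_eq0.
Qed.

Lemma re_horner (p : {poly dual F}) w c : re p.[Dual w c] = (map_poly (@re F) p).[w].
Proof. by rewrite -horner_map. Qed.

Lemma graph_poly0 G (gG : derivation_graph G) p :
  p \is a polyOver (graph_ring gG) -> map_poly (@re F) p = 0 -> p = 0.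
Proof.
move=> Gp p0; apply/polyP => i; rewrite coef0; apply: (graph_fun gG).
  by apply/graph_ringP/(polyOverP Gp).
by rewrite -coef_map p0 coef0.
Qed.

(** Let [f] be of minimal degree, over the graph, among the polynomials whose
    real part vanishes at [w].  If there is none, any [c] will do.  If
    the derivative of [f] does not vanish at [w], then [c] is the solution of
    the linear equation [f.[Dual w c] = 0].  If it does, then it is 0 by
    minimality; this is excluded in characteristic 0, and in characteristic [p]
    the polynomial ['X^p - w ^+ p] has minimal degree too and vanishes at
    [Dual w c] for every [c]. *)
Lemma graph_extend G (gG : derivation_graph G) w :
  [pchar F] =i pred0 \/ (exists2 p, p \in [pchar F] & forall x, x ^+ p \in L) ->
  exists c G', [/\ derivation_graph G', G `<=` G' & G' (Dual w c)].
Proof.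
move=> charF.
suff [c hc] : exists c, forall p, p \is a polyOver (graph_ring gG) ->
    re p.[Dual w c] = 0 -> p.[Dual w c] = 0.
  by exists c, (adjoin gG (Dual w c)); apply: adjoin_graph.
pose P n := `[< exists f : {poly dual F}, [/\ f \is a polyOver (graph_ring gG),
   f != 0, (map_poly (@re F) f).[w] = 0 & size f = n] >].
have [exP|nex] := pselect (exists n, P n); last first.
  exists 0 => p Gp pw; have [->|p0] := eqVneq p 0; first by rewrite horner0.
  by case: nex; exists (size p); apply/asboolP; exists p; rewrite -(re_horner p w 0).
case: (ex_minnP exP) => n /asboolP[f [Gf f0 fw sf]] minn.
have fmin c g : g \is a polyOver (graph_ring gG) -> re g.[Dual w c] = 0 ->
    (size g < size f)%N -> g = 0.
  move=> Gg; rewrite re_horner => gw lt; apply/eqP/negPn/negP => g0.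
  have /minn : P (size g) by apply/asboolP; exists g.
  by rewrite -sf leqNgt lt.
pose f' := (map_poly (@re F) f)^`().
have [f'w|f'w] := eqVneq f'.[w] 0; last first.
  exists (- (eps f.[Dual w 0] / f'.[w])); apply: (minimal_relation Gf) => //; last exact: fmin.
  rewrite [LHS]dual_horner; apply: dual_eq; first by rewrite rmorphD /= re_horner fw addr0.
  by rewrite epsD /= mulNr mulfVK // subrr.
have f'0 : f^`() = 0.
  apply: (fmin 0); first exact: polyOver_deriv; last exact: lt_size_deriv.
  by rewrite re_horner -deriv_map.
have s1 : (1 < size f)%N.
  rewrite ltnNge; apply/negP => /size1_polyC fE; case/eqP: f0.
  apply: (graph_poly0 Gf); move: fw; rewrite fE map_polyC hornerC /= => ->.
  by rewrite polyC0.
have lead0 : re (lead_coef f) != 0.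
  apply/eqP => a0; have : lead_coef f = 0.
    by apply: (graph_fun gG) => //; apply/graph_ringP/(polyOverP Gf).
  by apply/eqP; rewrite lead_coef_eq0.
have nF : (size f).-1%:R = 0 :> F.
  have /polyP/(_ (size f).-2) := f'0; rewrite coef_deriv coef0 prednK; last by lia.
  rewrite -lead_coefE => /(congr1 (@re F)) /eqP.
  by rewrite raddfMn raddf0 /= -(mulr_natr (re (lead_coef f))) mulf_eq0 (negbTE lead0) => /eqP.
case: charF => [/pcharf0P ch0|[p pF Lp]].
  by move/eqP: nF; rewrite ch0; lia.
have ps : (p < size f)%N.
  move/eqP: nF; rewrite -(dvdn_pcharf pF) => /(dvdn_leq _) le.
  have {}le : (p <= (size f).-1)%N by apply: le; rewrite -subn1 subn_gt0.
  by apply: (leq_ltn_trans le); rewrite ltn_predL (ltnW s1).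
have p0 := prime_gt0 (pcharf_prime pF).
exists 0; pose g := 'X^p - (Dual (w ^+ p) 0)%:P : {poly dual F}.
have sg : size g = p.+1 by rewrite size_XnsubC.
apply: (@minimal_relation _ gG _ g).
- rewrite rpredB ?rpredX ?polyOverX // polyOverC; apply/graph_ringP.
  exact: (graph_base gG).
- by rewrite -size_poly_eq0 sg.
- by rewrite hornerD hornerXn hornerN hornerC dual_exp mul0r mul0rn subrr.
- by move=> h Gh hw lt; apply: (fmin 0) => //; apply: leq_trans ps; rewrite -sg.
Qed.

(** The family to which Zorn's lemma is applied consists of the sets that become
    graphs after adding [G0]; unlike the family of graphs containing [G0] it is
    stable under the union of the empty chain. *)
Lemma graph_maximal G0 : derivation_graph G0 ->
  exists G, [/\ derivation_graph G, G0 `<=` G & forall G', derivation_graph G' -> G `<=` G' -> G' `<=` G].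
Proof.
move=> gG0; pose P (X : set (dual F)) := derivation_graph (X `|` G0).
have [|A [PA maxA]] := @Zorn_bigcup _ P.
  move=> C CP tot; pose W := \bigcup_(X in C) X.
  have sub X : C X -> X `|` G0 `<=` W `|` G0.
    by move=> CX x [Xx|]; [left; exists X | right].
  have two x y : (W `|` G0) x -> (W `|` G0) y ->
      exists2 H, derivation_graph H & [/\ H x, H y & H `<=` W `|` G0].
    case=> [[X CX Xx]|Gx] [[Y CY Yy]|Gy].
    - have [XY|YX] := tot X Y CX CY.
        exists (Y `|` G0); first exact: CP.
        by split; [left; apply: XY | left | apply: sub].
      exists (X `|` G0); first exact: CP.
      by split; [left | left; apply: YX | apply: sub].
    - exists (X `|` G0); first exact: CP.
      by split; [left | right | apply: sub].
    - exists (Y `|` G0); first exact: CP.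
      by split; [right | left | apply: sub].
    - by exists G0 => //; split=> // u; right.
  split.
  - by move=> q Lq; right; apply: (graph_base gG0).
  - by move=> x y /two h /h[H gH [Hx Hy sH]]; apply/sH/(graphB gH).
  - by move=> x y /two h /h[H gH [Hx Hy sH]]; apply/sH/(graphM gH).
  - by move=> x hx; have [H gH [Hx _ _]] := two x x hx hx; apply: (graph_fun gH).
exists (A `|` G0); split; [exact: PA | by move=> x Gx; right |].
move=> G' gG' sub x G'x; apply: contrapT => nx.
apply: (maxA G'); last first.
  rewrite /P; suff -> : G' `|` G0 = G' by [].
  by apply/seteqP; split=> y; [case=> // Gy; apply: sub; right | left].
split; first by move=> y Ay; apply: sub; left.
by move=> /(_ x G'x) Ax; apply: nx; left.
Qed.

Lemma derivation_of_graph G0 z : derivation_graph G0 -> G0 (Dual z 1) ->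
  [pchar F] =i pred0 \/ (exists2 p, p \in [pchar F] & forall x, x ^+ p \in L) ->
  exists D : F -> F, [/\ forall x y, D (x - y) = D x - D y,
    forall x y, D (x * y) = x * D y + D x * y,
    {in L, forall q, D q = 0} & D z = 1].
Proof.
move=> gG0 G0z charF; have [G [gG GG0 maxG]] := graph_maximal gG0.
have /choice[D GD] w : exists c, G (Dual w c).
  have [c [G' [gG' sub G'w]]] := graph_extend gG w charF.
  by exists c; apply: maxG G'w.
have uniqD w c : G (Dual w c) -> D w = c.
  move=> Gw; have /(graph_fun gG) := graphB gG (GD w) Gw.
  rewrite rmorphB /= subrr => /(_ erefl) /(congr1 (@eps F)).
  by rewrite epsB /= => /eqP; rewrite subr_eq0 => /eqP.
exists D; split.
- by move=> x y; apply: uniqD; have := graphB gG (GD x) (GD y).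
- move=> x y; apply: uniqD; exact: (graphM gG (GD x) (GD y)).
- by move=> q Lq; apply/uniqD/(graph_base gG).
- exact/uniqD/GG0.
Qed.

Lemma base_graph : derivation_graph (fun x => re x \in L /\ eps x = 0).
Proof.
split.
- by [].
- by move=> x y [Lx x0] [Ly y0]; rewrite rmorphB epsB x0 y0 subrr rpredB.
- by move=> x y [Lx x0] [Ly y0]; rewrite rmorphM epsM x0 y0 mulr0 mul0r addr0 rpredM.
- by move=> x [_ x0] x1; apply: dual_eq.
Qed.

(** The first case is that of [z] transcendental over [L].  In the second case
    ['X^p - z ^+ p] has minimal degree among the nonzero polynomials over [L]
    that vanish at [z], and its derivative is 0, so [z] may have derivative 1. *)
Lemma derivation_exists z :
  ([pchar F] =i pred0 /\
     forall f : {poly F}, f \is a polyOver L -> f != 0 -> f.[z] != 0) \/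
  (exists p, [/\ p \in [pchar F], forall x, x ^+ p \in L & z \notin L]) ->
  exists D : F -> F, [/\ forall x y, D (x - y) = D x - D y,
    forall x y, D (x * y) = x * D y + D x * y,
    {in L, forall q, D q = 0} & D z = 1].
Proof.
move=> hz.
suff h p : p \is a polyOver (graph_ring base_graph) ->
    re p.[Dual z 1] = 0 -> p.[Dual z 1] = 0.
  have [gG _ Gz] := adjoin_graph h; apply: derivation_of_graph gG Gz _.
  by case: hz => [[? _]|[q [? ? _]]]; [left | right; exists q].
have Lre (g : {poly dual F}) : g \is a polyOver (graph_ring base_graph) ->
    map_poly (@re F) g \is a polyOver L.
  move=> Gg; apply/polyOverP => i; rewrite coef_map.
  by have /graph_ringP[] := polyOverP Gg i.
case: hz => [[_ tr]|[q [qF Lq nz]]] Gp.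
  rewrite re_horner => pz; have [p0|p0] := eqVneq (map_poly (@re F) p) 0.
    by rewrite (graph_poly0 Gp p0) horner0.
  by have := tr _ (Lre _ Gp) p0; rewrite pz eqxx.
move: Gp; have q0 := prime_gt0 (pcharf_prime qF).
pose g := 'X^q - (Dual (z ^+ q) 0)%:P : {poly dual F}.
have sg : size g = q.+1 by rewrite size_XnsubC.
apply: (@minimal_relation _ base_graph _ g).
- rewrite rpredB ?rpredX ?polyOverX // polyOverC; apply/graph_ringP.
  exact: (graph_base base_graph).
- by rewrite -size_poly_eq0 sg.
- rewrite hornerD hornerXn hornerN hornerC dual_exp -mulr_natr.
  by rewrite (pcharf0 qF) mulr0 subrr.
move=> h Gh; rewrite re_horner sg => hz lt; apply: (graph_poly0 Gh).
apply/eqP/negPn/negP => h0.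
have := purely_inseparable_size qF (Lq z) nz (Lre _ Gh) h0 hz.
by apply/negP; rewrite -leqNgt (leq_trans (size_poly _ _)).
Qed.

End Graph.

(** * The ring twisted by a derivation *)

Section Twisted.
Variables (F : fieldType) (U V : subringClosed F) (t : F).
Hypothesis imm : immediate_at U V t.
Variables (D : F -> F) (z : F).
Hypothesis DB : forall x y, D (x - y) = D x - D y.
Hypothesis DM : forall x y, D (x * y) = x * D y + D x * y.
Hypothesis DQ : {in quotient_field U, forall q, D q = 0}.
Hypothesis Dz : D z = 1.

Let t0 : t != 0 := imm_t0 imm.
Let tX0 n : t ^+ n != 0 := imm_tX0 imm n.
Let tU : t \in U := imm_t imm.
Let tV : t \in V := imm_sub imm tU.

Lemma der0 : D 0 = 0. Proof. by have := DB 0 0; rewrite !subrr. Qed.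
Lemma derN x : D (- x) = - D x. Proof. by rewrite -[- x]add0r DB der0 add0r. Qed.
Lemma derD x y : D (x + y) = D x + D y.
Proof. by rewrite -{1}[y]opprK DB derN opprK. Qed.
Lemma derU u : u \in U -> D u = 0.
Proof. by move=> /(imm_U_frac) /DQ. Qed.
Lemma derX n : D (t ^+ n) = 0. Proof. exact/DQ/(imm_tX_frac imm). Qed.
Lemma derZ q x : q \in quotient_field U -> D (q * x) = q * D x.
Proof. by move=> Qq; rewrite DM (DQ Qq) mul0r addr0. Qed.
Lemma der_div x n : D (x / t ^+ n) = D x / t ^+ n.
Proof. by rewrite mulrC derZ ?rpredV ?(imm_tX_frac imm) // mulrC. Qed.
Lemma derV x : x != 0 -> D x^-1 = - D x / x ^+ 2.
Proof.
move=> x0; have := DM x x^-1; rewrite divff // derU ?rpred1 // => h.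
have {h} : x * D x^-1 = - (D x / x) by apply/eqP; rewrite -addr_eq0 -h.
by move=> h; apply: (mulfI x0); rewrite h; field.
Qed.

Definition twisted : {pred F} := [pred x | (x \in V) && (D x \in V)].


Lemma twisted_subring : subring_closed twisted.
Proof.
split.
- by apply/andP; rewrite derU ?rpred1 ?rpred0.
- move=> x y /andP[Vx Dx] /andP[Vy Dy]; apply/andP.
  by rewrite DB !rpredB.
- move=> x y /andP[Vx Dx] /andP[Vy Dy]; apply/andP.
  by rewrite DM rpredD ?rpredM.
Qed.

Definition twisted_ring : subringClosed F :=
  HB.pack twisted (GRing.isSubringClosed.Build F twisted twisted_subring).
Local Notation R := twisted_ring.

Lemma twistedP x : reflect (x \in V /\ D x \in V) (x \in R).
Proof. exact: andP. Qed.

Lemma U_twisted : {subset U <= R}.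
Proof. by move=> u Uu; apply/twistedP; rewrite derU // rpred0 (imm_sub imm). Qed.

Lemma twisted_V : {subset R <= V}.
Proof. by move=> x /twistedP[]. Qed.

Lemma twisted_div n x :
  x / t ^+ n \in V -> D x / t ^+ n \in V -> x / t ^+ n \in R.
Proof. by move=> Vx Vd; apply/twistedP; rewrite der_div. Qed.

(** [q * z] has derivative [q], and subtracting from it an approximation in [Q]
    makes it small without changing the derivative. *)
Lemma preimage_small n q : q \in quotient_field U ->
  exists2 y, y / t ^+ n \in V & D y = q.
Proof.
move=> Qq; have [r Qr Vr] := imm_approx_frac imm n (q * z).
by exists (q * z - r); rewrite // DB derZ // Dz mulr1 (DQ Qr) subr0.
Qed.

Lemma twisted_unit x : x \in R -> x \in units_of V -> x \in units_of R.
Proof.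
move=> Rx /and3P[x0 Vx Vx']; apply/and3P; split=> //; apply/twistedP.
case/twistedP: Rx => _ Dx; split=> //.
by rewrite derV // mulNr rpredN -exprVn rpredM ?rpredX.
Qed.

Lemma twisted_nonunit (x : subring_type R) :
  (x \in @nonunits (subring_type R)) = (val x / t \in V).
Proof.
rewrite inE /= -[x \is a GRing.unit]/(val x \in units_of R).
apply/idP/idP => [nux|Vx].
  have [ux|//] := imm_unit_or imm (twisted_V (valP x)).
  by case/negP: nux; apply: twisted_unit ux; apply: valP.
apply: contraL Vx => /and3P[x0 Rx Rx']; apply: (imm_unitN imm).
by apply/and3P; split=> //; apply: twisted_V.
Qed.

Lemma twisted_local : local_ring (subring_type R).
Proof.
split.
- by rewrite twisted_nonunit rmorph0 mul0r rpred0.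
- by rewrite twisted_nonunit rmorph1 (imm_unitN imm) // (imm_unit1 V).
- move=> a x y; rewrite !twisted_nonunit => Vx Vy.
  rewrite rmorphD rmorphM mulrDl -mulrA rpredD // rpredM //.
  exact/twisted_V/valP.
Qed.

Lemma twisted_frac x : exists c, x * t ^+ c \in R.
Proof.
have [a Va] := imm_frac imm x; have [b Vb] := imm_frac imm (D x).
exists (a + b)%N; apply/twistedP; rewrite DM derX mulr0 add0r; split.
  by rewrite exprD mulrA rpredM ?rpredX.
by rewrite addnC exprD mulrA rpredM ?rpredX.
Qed.

(** For [x] in [V] and [u] in [U] close to [x], the element [(x - u) ^+ 2] is in
    [R], since its derivative is [2 * (x - u) * D x] and [x - u] can be taken
    small enough to compensate for the denominator of [D x]. *)
Lemma twisted_normalization : normalization R =i V.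
Proof.
move=> x; apply/asboolP/idP => [[_ /integralOver_deg[n [r Rr h]]]|Vx].
  have [//|Vx'] := imm_val imm x.
  have [->|x0] := eqVneq x 0; first exact: rpred0.
  rewrite -[x]invrK -div1r -[1](expr1n _ n).
  apply: integral_deg_div; rewrite ?rpred1 ?invr_eq0 // div1r invrK.
  by exists r => // i; apply: twisted_V.
split.
  have [c Rc] := twisted_frac x; apply/asboolP; exists (x * t ^+ c), (t ^+ c).
  by rewrite mulfK // tX0 rpredX // U_twisted.
have [n Vn] := imm_frac imm (D x).
have [u Uu Vu] := imm_approx imm n Vx.
have Rw : (x - u) ^+ 2 \in R.
  apply/twistedP; split; first by apply: rpredX; apply: rpredB => //; apply: (imm_sub imm).
  rewrite expr2 DM DB (derU Uu) subr0.
  have -> : (x - u) * D x + D x * (x - u)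
      = ((x - u) / t ^+ n * (D x * t ^+ n)) *+ 2 by rewrite mulr2n; field.
  by rewrite rpredMn // rpredM.
rewrite -(subrK u x); apply: integral_add; last first.
  exact: (integral_id (val : subring_type R -> F) (SubringType (U_twisted Uu))).
exists ('X^2 - (SubringType Rw)%:P); first exact: monicXnsubC.
have E (f : {rmorphism subring_type R -> F}) c : root (map_poly f ('X^2 - c%:P)) (x - u)
    = (f c == (x - u) ^+ 2).
  by rewrite rmorphB /= map_polyXn map_polyC rootE !hornerE subr_eq0 eq_sym.
by rewrite (E (\val : {rmorphism subring_type R -> F})) /=.
Qed.

(** Let [I] be a nonzero ideal.  It contains some [t ^+ n]; let [a] in [I] be
    such that [D a] has the largest absolute value.  Subtracting from [x] in [I]
    a [U]-multiple of [a] gives [y] with [D y] in [t ^+ n * V], hence [y] is the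
    sum of an element [w] of [U] and an element of [t ^+ n * R].  So [w] is in
    the ideal of [U] cut out by [I], which is generated by some [t ^+ i], and
    [I] is generated by [a], [t ^+ n] and [t ^+ i]. *)
Lemma twisted_noetherian : noetherian (subring_type R).
Proof.
move=> I; pose J x := exists2 r : subring_type R, r \in I & val r = x.
have JD x y : J x -> J y -> J (x + y).
  by move=> [a Ia <-] [b Ib <-]; exists (a + b); rewrite ?rmorphD // rpredD.
have JM a x : a \in R -> J x -> J (a * x).
  move=> Ra [b Ib <-]; exists (SubringType Ra * b); last by rewrite rmorphM.
  exact: idealMr.
have JB x y : J x -> J y -> J (x - y).
  by move=> Jx Jy; rewrite -mulN1r; apply: JD => //; apply: JM; rewrite ?rpredN1.
have [J0|nz] := pselect (forall x, J x -> x = 0).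
  exists [::] => x; apply/idP/asboolP => [Ix|[c cs ->]].
    exists [::] => //; rewrite big_nil; apply: val_inj; rewrite rmorph0.
    by apply: J0; exists x.
  by case: c cs => [|c c' /(_ c (mem_head _ _))//]; rewrite big_nil rpred0.
have [g Jg g0] : exists2 g, J g & g != 0.
  apply: contrapT => h; apply: nz => x Jx; apply/eqP/negPn/negP => x0.
  by apply: h; exists x.
have [n Jn] : exists n, J (t ^+ n).
  have [c Rc] := twisted_frac g^-1; exists c.
  by rewrite -(mulVKf g0 (t ^+ c)) mulrC; apply: JM.
have [x1 Jx1 hx1] : exists2 x1, J x1 & forall x, J x ->
    exists2 u, u \in U & D (x - u * x1) / t ^+ n \in V.
  have [DJ0|nzD] := pselect (forall x, J x -> D x = 0).
    exists 0; first by exists 0; rewrite ?rpred0 ?rmorph0.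
    by move=> x Jx; exists 0; rewrite ?rpred0 // mul0r subr0 DJ0 // mul0r rpred0.
  pose P m := `[< exists2 x, J x & D x / t ^+ m \in units_of V >].
  have JP x : J x -> D x != 0 -> exists2 m, P m & D x / t ^+ m \in units_of V.
    move=> Jx Dx0; have VDx : D x \in V by case: Jx => r _ <-; case/twistedP: (valP r).
    have [m um] := imm_ord imm Dx0 VDx; exists m => //.
    by apply/asboolP; exists x.
  have exP : exists m, P m.
    apply: contrapT => h; apply: nzD => x Jx; apply/eqP/negPn/negP => Dx0.
    by have [m Pm _] := JP x Jx Dx0; apply: h; exists m.
  case: (ex_minnP exP) => m /asboolP[x1 Jx1 /and3P[D10 VD1 VD1']] minm.
  exists x1 => // x Jx.
  have {D10} D10 : D x1 != 0 by move: D10; rewrite mulf_eq0 negb_or => /andP[].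
  have Vc : D x / D x1 \in V.
    have [->|Dx0] := eqVneq (D x) 0; first by rewrite mul0r rpred0.
    have [k /minm le /and3P[_ Vk _]] := JP x Jx Dx0.
    have -> : D x / D x1 = D x / t ^+ k * (D x1 / t ^+ m)^-1 * t ^+ (k - m).
      by rewrite -{1}(subnK le) exprD; field; rewrite D10 !tX0.
    by apply: rpredM; [apply: rpredM | apply: rpredX].
  (* [u] approximates [D x / D x1], which is in [V] by the choice of [x1]. *)
  have [u Uu Vu] := imm_approx imm n Vc; exists u => //.
  rewrite DB derZ ?imm_U_frac //.
  have -> : (D x - u * D x1) / t ^+ n = (D x / D x1 - u) / t ^+ n * D x1.
    by field; rewrite D10 tX0.
  by apply: rpredM => //; case: Jx1 => r _ <-; case/twistedP: (valP r).
have [i Ji hi] : exists2 i, J (t ^+ i) & forall u, u \in U -> J u -> u / t ^+ i \in U.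
  have exP : exists i, `[< J (t ^+ i) >] by exists n; apply/asboolP.
  case: (ex_minnP exP) => i /asboolP Ji mini; exists i => // u Uu Ju.
  apply: (imm_U_div imm) => //.
  have [->|u0] := eqVneq u 0; first by rewrite mul0r rpred0.
  have [k /and3P[_ Vk Vk']] := imm_ord imm u0 (imm_sub imm Uu).
  apply: (imm_div_le imm _ Vk); apply: mini; apply/asboolP.
  have -> : t ^+ k = (u / t ^+ k)^-1 * u by rewrite invf_div divfK.
  apply: JM => //; apply/U_twisted/(imm_int imm) => //.
  by rewrite rpredV rpred_div ?(imm_tX_frac imm) ?imm_U_frac.
case: Jx1 Jn Ji hi hx1 => a Ia <- [b Ib bE] [c Ic cE] hi hx1.
exists [:: a; b; c] => x; apply/idP/asboolP => [Ix|[s sI ->]]; last first.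
  rewrite big_seq; apply: rpred_sum => d /sI h; apply: idealMr.
  by move: h; rewrite !inE => /or3P[]/eqP->.
have [u Uu Vz] := hx1 (val x) (ex_intro2 _ _ x Ix erefl).
set y := val x - u * val a in Vz.
have Ry : y \in R.
  apply: rpredB; first exact: (valP x).
  by apply: rpredM; [exact: (U_twisted Uu) | exact: (valP a)].
have [w Uw Vw] := imm_approx imm n (twisted_V Ry).
have Rv : (y - w) / t ^+ n \in R.
  by apply: twisted_div; rewrite // DB (derU Uw) subr0.
have Jw : J w.
  have -> : w = y - (y - w) / t ^+ n * t ^+ n by rewrite mulfVK // opprB addrC subrK.
  apply: (JB); last by apply: (JM); rewrite // -bE; exists b.
  apply: (JB); first by exists x.
  by apply: (JM); [exact: (U_twisted Uu) | exists a].
have Rr := U_twisted (hi _ Uw Jw).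
exists [:: (SubringType (U_twisted Uu), a); (SubringType Rv, b); (SubringType Rr, c)].
  by move=> d; rewrite !inE => /or3P[] /eqP-> /=; rewrite eqxx ?orbT.
apply: val_inj; rewrite !big_cons big_nil addr0 !rmorphD !rmorphM /= bE cE.
rewrite !divfK ?tX0 // /y subrK addrC; exact: (esym (subrK _ _)).
Qed.

(** The sequence [s] with [s n] in [t ^+ n * V] and [D (s n) = 1] is a Cauchy
    sequence, as [s m - s n] has derivative 0.  Its square is a null sequence,
    as the derivative of [s n ^+ 2] is [2 * s n].  It is not a null sequence,
    since [D] maps the square of the maximal ideal into [t * V]. *)
Lemma twisted_ramified : analytically_ramified (subring_type R).
Proof.
pose M : idealr (subring_type R) :=
  HB.pack (@nonunits (subring_type R)) (isIdealr.Build (subring_type R) _ twisted_local).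
have MV (x : subring_type R) : (x \in M) = (val x / t \in V) := twisted_nonunit x.
exists M => //; apply/completion_nilpotentP.
have /choice[s sP] n : exists y : subring_type R, val y / t ^+ n \in V /\ D (val y) = 1.
  have [y Vy Dy] := preimage_small n (rpred1 (quotient_field U)).
  have Ry : y \in R by apply/twistedP; rewrite Dy rpred1 (imm_div_mem imm Vy).
  by exists (SubringType Ry).
have small k n : (k <= n)%N -> val (s n) / t ^+ k \in V.
  by move=> le; apply: (imm_div_le imm le); case: (sP n).
have sC : s \in adic_cauchy M.
  apply/asboolP => k; exists k => m n km kn.
  apply: (ideal_pow_mem imm U_twisted MV); apply: twisted_div; rewrite rmorphB.
    by rewrite mulrBl rpredB // small.
  by rewrite DB !(sP _).2 subrr mul0r rpred0.
exists (CauchySeq sC); last first.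
  exists 2%N; apply/asboolP => k; exists k => n kn; rewrite cauchy_valX /=.
  apply: (ideal_pow_mem imm U_twisted MV); apply: twisted_div; rewrite rmorphXn /= expr2.
    by rewrite -mulrA rpredM ?small //; apply: twisted_V; apply: (valP (s n)).
  by rewrite DM (sP _).2 mulr1 mul1r mulrDl rpredD // small.
apply/negP => /asboolP/(_ 2%N)[n /(_ n (leqnn n))] /= /asboolP[c cM] /(congr1 val).
have Vval (x : subring_type R) : val x \in V by apply/twisted_V/valP.
have VD (x : subring_type R) : D (val x) \in V by case/twistedP: (valP x).
suff : D (val (\sum_(d <- c) d.1 * d.2)) / t \in V.
  by move=> h E; rewrite -E (sP n).2 in h; case/negP: (imm_unitN imm (imm_unit1 V)).
rewrite big_seq; elim/big_ind: _ => [||d /cM /asboolP[a [b [Ma Mb ->]]]].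
- by rewrite rmorph0 der0 mul0r rpred0.
- by move=> x y Vx Vy; rewrite rmorphD derD mulrDl rpredD.
have {Mb} Vb : val b / t \in V.
  by have := ideal_pow_sub twisted_V MV (Mb : b \in ideal_pow M 1); rewrite expr1.
have Va : val a / t \in V by rewrite -MV.
rewrite !rmorphM /= !DM.
have -> : (val d.1 * (val a * D (val b) + D (val a) * val b)
    + D (val d.1) * (val a * val b)) / t
  = val d.1 * (val a / t * D (val b) + D (val a) * (val b / t))
    + D (val d.1) * (val a * (val b / t)) by ring.
by apply: rpredD; apply: rpredM => //; [apply: rpredD|]; apply: rpredM.
Qed.

End Twisted.

(** * The equivalence *)

Lemma generated_subfield_divring (F : fieldType) (G : {pred F}) :
  divring_closed (generated_subfield G).
Proof.
split.
- by apply/asboolP => K _; apply: rpred1.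
- by move=> x y /asboolP hx /asboolP hy; apply/asboolP => K GK; rewrite rpredB ?hx ?hy.
- by move=> x y /asboolP hx /asboolP hy; apply/asboolP => K GK; rewrite rpred_div ?hx ?hy.
Qed.

Lemma poly_algebraic (F : fieldType) (U : subringClosed F) (f : {poly F}) z :
  f \is a polyOver (quotient_field U) -> f != 0 -> root f z ->
  algebraicOver (val : quotient_field_type U -> F) z.
Proof.
move=> /polyOverP Qf f0 fz.
pose g : {poly quotient_field_type U} := \poly_(i < size f) QuotientFieldType (Qf i).
have gE : map_poly (val : quotient_field_type U -> F) g = f.
  apply/polyP => i; rewrite coef_map_id0 ?rmorph0 // coef_poly.
  by case: ltnP => [//|le]; rewrite rmorph0 nth_default.
exists g; last by rewrite gE.
by apply: contraNneq f0 => g0; rewrite -gE g0 map_poly0.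
Qed.

Theorem corollary4p2 (F : fieldType) (U V : subringClosed F)
  (dvrU : dvr U) (dvrV : dvr V) (fracV : quotient_field V =i predT)
  (immUV : immediate_extension U V) :
  (exists R : subringClosed F,
     [/\ {subset U <= R},
         local_ring (subring_type R),
         noetherian (subring_type R),
         normalization R =i V
       & analytically_ramified (subring_type R)])
  <->
  ([pchar F] =i pred0 /\ ~ algebraic_over_quotient_field U
   \/
   exists2 p : nat, p \in [pchar F] &
     ~ (generated_subfield [predU quotient_field U & pth_powers p]
          =i predT)).
Proof.
have [t imm] := immediate_atP dvrU dvrV fracV immUV.
split=> [[R [UR _ noethR normR ramR]]|charF].
  exact: ramified_transcendental_or_inseparable imm fracV UR noethR normR ramR.
have [D [z [DB DM DQ Dz]]] : exists D z, [/\ forall x y, D (x - y) = D x - D y,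
    forall x y, D (x * y) = x * D y + D x * y,
    {in quotient_field U, forall q, D q = 0} & D z = 1].
  case: charF => [[ch0 /existsNP[z nalg]]|[p pF ngen]].
    have [|D hD] := @derivation_exists F (quotient_field U) z; last by exists D, z.
    left; split=> // f Qf f0; apply/negP => fz; apply: nalg.
    exact: poly_algebraic Qf f0 fz.
  pose G := [predU quotient_field U & pth_powers p].
  pose L : divringClosed F := HB.pack (generated_subfield G)
    (GRing.isDivringClosed.Build F _ (generated_subfield_divring G)).
  have GL : {subset G <= L} by move=> x Gx; apply/asboolP => K; apply.
  have [z Lz] : exists z, z \notin L.
    apply: contrapT => h; apply: ngen => x; apply/negPn/negP => Lx.
    by apply: h; exists x.
  have [|D [DB DM DL Dz]] := @derivation_exists F L z.
    right; exists p; split=> // x; apply: GL; rewrite inE; apply/orP; right.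
    by apply/asboolP; exists x.
  exists D, z; split=> // q Qq; apply/DL/GL; rewrite inE; apply/orP; left.
  exact: Qq.
exists (twisted_ring V DB DM DQ); split.
- exact: (U_twisted imm).
- exact: (twisted_local imm).
- exact: (twisted_noetherian imm).
- exact: (twisted_normalization imm).
- exact: (twisted_ramified imm DB DM DQ Dz).
Qed.
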